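(* Let $n\ge 2$ and let $K\subset\mathbb{R}^n$ be an $n$-dimensional convex body. If there exists a nonempty open subset of the Grassmannian $G_{n-1,n}$ all of whose elements are strong-Bezdek hyperplanes for $K$, then $K$ is either an ellipsoid or an $\mathbb{S}^1$-rotational body.
   Context: A convex body is a compact convex set with nonempty interior. $G_{n-1,n}$ is the Grassmannian of hyperplanes through the origin in $\mathbb{R}^n$. A reflection $\mathbf{r}:\mathbb{R}^n\to\mathbb{R}^n$ is a (not necessarily orthogonal, not necessarily linear) affine reflection: there are an affine hyperplane $M$, the mirror, which is fixed pointwise, and a line $\ell$ through the origin, the direction, which is not parallel to $M$, such that every line parallel to $\ell$ is rigidly inverted by $\mathbf{r}$ at its point of intersection with $M$. The reflection is orthogonal if its direction is orthogonal to its mirror. A reflection of $K$ is a reflection $\mathbf{r}$ with $\mathbf{r}(K)=K$. A hyperplane $\Gamma$ is a ground hyperplane of a reflection $\mathbf{r}$ if $\Gamma$ contains the direction of $\mathbf{r}$ (hence $\Gamma$ is invariant under $\mathbf{r}$) and the restriction of $\mathbf{r}$ to $\Gamma$ is an orthogonal reflection in $\Gamma$ (i.e. the direction $\ell$ is orthogonal to $M\cap\Gamma$); this notion depends on $\Gamma$ only up to parallelism, so ground hyperplanes are taken to pass through the origin. A hyperplane $\Gamma$ is strong-Bezdek for $K$ if it is a ground hyperplane of some reflection of $K$. (Equivalently, up to parallelism, the section $\Gamma\cap K$ admits an orthogonal reflection in $\Gamma$ which extends to a reflection of $K$.) An ellipsoid in $\mathbb{R}^n$ is the image of a ball under an affine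 automorphism of $\mathbb{R}^n$. A convex body $K\subset\mathbb{R}^n$ is an $\mathbb{S}^1$-rotational body if there is an $(n-2)$-dimensional flat (affine subspace) $L$ such that for every 2-dimensional plane $P$ orthogonal to $L$, the section $P\cap K$ is either empty, a single point, or a disk centered at $L\cap P$. *)

(* Defs.v *)
From HB Require Import structures.
From mathcomp Require Import all_boot all_order all_algebra.
From mathcomp Require Import all_classical all_reals all_analysis.

Set Implicit Arguments.
Unset Strict Implicit.
Unset Printing Implicit Defensive.

Import Order.TTheory GRing.Theory Num.Theory.
Import numFieldNormedType.Exports.

Local Open Scope classical_set_scope.
Local Open Scope ring_scope.

(** * Euclidean structure *)

(* The norm that the library puts on ['rV[R]_n] is the sup norm: it defines the
   right topology but not the right balls, angles or ellipsoids. *)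
Definition dot (R : realType) (n : nat) (u v : 'rV[R]_n) : R :=
  \sum_(i < n) u ord0 i * v ord0 i.

Definition eball (R : realType) (n : nat) (c : 'rV[R]_n) (e : R) :
    set 'rV[R]_n :=
  [set x | Num.sqrt (dot (x - c) (x - c)) <= e].

Definition orthov (R : realType) (n : nat) (V W : {vspace 'rV[R]_n}) : Prop :=
  forall v w, v \in V -> w \in W -> dot v w = 0.

(* The affine subspace through [p] with direction [W]. *)
Definition flat (R : realType) (n : nat) (p : 'rV[R]_n)
    (W : {vspace 'rV[R]_n}) : set 'rV[R]_n :=
  [set x | x - p \in W].

(** * The Grassmannian *)

Section Grassmannian.
Variables (R : realType) (k n : nat).

Definition grassmannian : Type := {W : {vspace 'rV[R]_n} | \dim W == k}.
HB.instance Definition _ := Choice.on grassmannian.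

Definition rows (A : 'M[R]_(k, n)) : k.-tuple 'rV[R]_n :=
  [tuple row i A | i < k].

Definition stiefel : set 'M[R]_(k, n) := [set A | free (rows A)].

Definition frames (U : set grassmannian) : set 'M[R]_(k, n) :=
  [set A | exists2 W : grassmannian, U W & val W = <<rows A>>%VS].

Lemma framesT : frames setT = stiefel.
Proof.
apply/seteqP; split=> A /=.
  by case=> W _ defW; move: (valP W); rewrite /stiefel /mkset /free size_tuple defW.
move=> fA; have dA : \dim <<rows A>>%VS == k.
  by move: fA; rewrite /stiefel /mkset /free size_tuple.
by exists (exist (fun W : {vspace _} => is_true (\dim W == k)) _ dA).
Qed.

Lemma framesI U V : frames (U `&` V) = frames U `&` frames V.
Proof.
apply/seteqP; split=> A /=.
  by case=> W [UW VW] defW; split; exists W.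
case=> -[W UW defW] [W' VW' defW']; exists W => //; split=> //.
by rewrite (_ : W = W') //; apply: val_inj; rewrite /= defW defW'.
Qed.

Lemma frames_bigcup (I : Type) (f : I -> set grassmannian) :
  frames (\bigcup_i f i) = \bigcup_i frames (f i).
Proof.
apply/seteqP; split=> A /=.
  by case=> W [i _ fW] defW; exists i => //; exists W.
by case=> i _ [W fW defW]; exists W => //; exists i.
Qed.

(* Quotient topology of the space of [k]-frames (with the topology induced by
   that of matrices) under the map sending a frame to the subspace it spans. *)
Definition grassmannian_open (U : set grassmannian) : Prop :=
  open (frames U : set (subspace stiefel)).

Lemma grassmannian_openT : grassmannian_open setT.
Proof. by rewrite /grassmannian_open framesT; exact: open_subspaceT. Qed.

Lemma grassmannian_openI : setI_closed grassmannian_open.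
Proof. by move=> U V oU oV; rewrite /grassmannian_open framesI; exact: openI. Qed.

Lemma grassmannian_open_bigU (I : Type) (f : I -> set grassmannian) :
  (forall i, grassmannian_open (f i)) -> grassmannian_open (\bigcup_i f i).
Proof.
move=> of_; rewrite /grassmannian_open frames_bigcup.
by apply: bigcup_open => i _; exact: of_.
Qed.

HB.instance Definition _ := isOpenTopological.Build grassmannian
  grassmannian_openT grassmannian_openI grassmannian_open_bigU.

Lemma open_grassmannianE (U : set grassmannian) : open U = grassmannian_open U.
Proof. by []. Qed.

End Grassmannian.

(** * Convex bodies *)

Definition convex_body (R : realType) (n : nat) (K : set 'rV[R]_n) : Prop :=
  [/\ compact K, convex_set K & K° !=set0].

Definition ellipsoid (R : realType) (n : nat) (K : set 'rV[R]_n) : Prop :=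
  exists (c : 'rV[R]_n) (e : R) (A : 'M[R]_n) (b : 'rV[R]_n),
    [/\ 0 < e, A \in unitmx & K = (fun x => x *m A + b) @` eball c e].

(* [flat q V] is the axis; the planes orthogonal to it are the translates
   [flat p W] of its orthogonal complement, and each meets it in one point. *)
Definition S1_rotational (R : realType) (n : nat) (K : set 'rV[R]_n) : Prop :=
  exists (q : 'rV[R]_n) (V : {vspace 'rV[R]_n}),
    (\dim V).+2 = n /\
    forall (p : 'rV[R]_n) (W : {vspace 'rV[R]_n}),
      \dim W = 2%N -> orthov V W ->
      [\/ flat p W `&` K = set0,
          exists x, flat p W `&` K = [set x]
        | exists (c : 'rV[R]_n) (e : R),
            [/\ 0 < e, flat q V `&` flat p W = [set c]
              & flat p W `&` K = flat p W `&` eball c e]].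

(** * Affine reflections *)

(* [r] is the affine reflection with mirror [M] and direction [l].  The line
   parallel to [l] that meets [M] at [m] is [m + l]; as [l] is not parallel to
   [M], these lines cover the space.  The case [v = 0] says that [M] is fixed
   pointwise. *)
Definition reflection (R : realType) (n : nat) (r : 'rV[R]_n -> 'rV[R]_n)
    (M : set 'rV[R]_n) (l : {vspace 'rV[R]_n}) : Prop :=
  exists (p : 'rV[R]_n) (W : {vspace 'rV[R]_n}),
    [/\ M = flat p W, (\dim W).+1 = n, \dim l = 1%N, ~~ (l <= W)%VS
      & forall m v, M m -> v \in l -> r (m + v) = m - v].

(* The last condition says that [l] is orthogonal to the flat [M :&: G]. *)
Definition ground_hyperplane (R : realType) (n : nat)
    (r : 'rV[R]_n -> 'rV[R]_n) (G : {vspace 'rV[R]_n}) : Prop :=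
  exists (M : set 'rV[R]_n) (l : {vspace 'rV[R]_n}),
    [/\ reflection r M l, (\dim G).+1 = n, (l <= G)%VS
      & forall x y v, M x -> M y -> x \in G -> y \in G -> v \in l ->
          dot (x - y) v = 0].

Definition strong_bezdek (R : realType) (n : nat) (K : set 'rV[R]_n)
    (G : {vspace 'rV[R]_n}) : Prop :=
  exists r : 'rV[R]_n -> 'rV[R]_n, r @` K = K /\ ground_hyperplane r G.

(* Main.v *)
Require Import Defs.
From mathcomp Require Import all_boot all_order all_algebra.
From mathcomp Require Import all_classical all_reals all_analysis.
From mathcomp Require Import ring lra.

Set Implicit Arguments.
Unset Strict Implicit.
Unset Printing Implicit Defensive.

Import Order.TTheory GRing.Theory Num.Theory.
Import numFieldNormedType.Exports.

Local Open Scope classical_set_scope.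
Local Open Scope ring_scope.

(** The symmetries of a convex body [K] form a bounded group.  The circumcentre
    argument [minimax_fixed_point], applied first to quadratic forms and then to
    the points of [K], yields a positive definite form [B] and a centre [x0] that
    all affine symmetries of [K] preserve ([invariant_structure]).  Every
    reflection of [K] is then the [B]-orthogonal reflection through [x0] in some
    direction [u], taken of [B]-length one.  The set of these directions,
    [mirror_dirs], is compact, and stable under the reflections it parametrises.

    Let [g] be normal to a ground hyperplane of the reflection in [u].  Being
    orthogonal for [B] and, inside the hyperplane, also for the Euclidean product
    means that [u *m B] is a combination of [u] and [g]: the direction [u] is an
    eigenvector of the compression of [B] to the hyperplane
    ([strong_bezdek_direction]).

    Two mirror directions at a small angle generate a dihedral group, hence
    equally spaced mirror directions all around a circle; so mirror directions
    that accumulate produce a whole circle of mirror directions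
    ([mirror_circle]).  This is used twice.

    If the eigenvectors of [B] among the mirror directions accumulate, there is a
    circle of mirrors in a plane inside an eigenspace of [B].  There [B] is
    proportional to the Euclidean product, so [K] is invariant under the
    rotations about the orthogonal complement of that plane
    ([rotational_of_circle]).

    Otherwise they are finite in number, and for [g] outside finitely many
    hyperplanes the mirror direction [u] attached to [g] is not an eigenvector of
    [B].  Such a [u] determines the line of [g], since [g] is proportional to the
    component of [u *m B] orthogonal to [u]; conversely the eigenvectors of a
    compression are isolated from one another, being pairwise orthogonal.
    Covering the mirror directions by finitely many small balls, one of them
    serves all [g] in some open set, and then the open set of unit vectors near it
    whose [g] falls in that open set consists of mirror directions
    ([mirrors_everywhere_or_eigen_circle]).  By the circle argument every unit
    vector is a mirror direction, the reflections of [K] act transitively on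
    [B]-spheres, and [K] is an ellipsoid ([ellipsoid_of_mirrors]). *)

(** * The standard inner product *)

Section Dot.
Variables (R : realType) (n : nat).
Implicit Types (u v w x y : 'rV[R]_n) (B : 'M[R]_n).

Lemma dotE u v : dot u v = (u *m v^T) 0 0.
Proof. by rewrite mxE; apply: eq_bigr => i _; rewrite mxE. Qed.

Lemma dotC u v : dot u v = dot v u.
Proof. by apply: eq_bigr => i _; rewrite mulrC. Qed.

Lemma dotDl u v w : dot (u + v) w = dot u w + dot v w.
Proof. by rewrite !dotE mulmxDl mxE. Qed.

Lemma dotDr u v w : dot w (u + v) = dot w u + dot w v.
Proof. by rewrite dotC dotDl !(dotC w). Qed.

Lemma dotNl u w : dot (- u) w = - dot u w.
Proof. by rewrite !dotE mulNmx mxE. Qed.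

Lemma dotNr u w : dot w (- u) = - dot w u.
Proof. by rewrite dotC dotNl (dotC w). Qed.

Lemma dotZl a u w : dot (a *: u) w = a * dot u w.
Proof. by rewrite !dotE -scalemxAl mxE. Qed.

Lemma dotZr a u w : dot w (a *: u) = a * dot w u.
Proof. by rewrite dotC dotZl (dotC w). Qed.

Lemma dot0l u : dot 0 u = 0.
Proof. by rewrite dotE mul0mx mxE. Qed.

Lemma dot0r u : dot u 0 = 0.
Proof. by rewrite dotC dot0l. Qed.

Definition dot_linE := (dotDl, dotDr, dotNl, dotNr, dotZl, dotZr).

Lemma dot_ge0 u : 0 <= dot u u.
Proof. by apply: sumr_ge0 => i _; rewrite -expr2 sqr_ge0. Qed.

Lemma dot_eq0 u : (dot u u == 0) = (u == 0).
Proof.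
apply/idP/eqP => [|->]; last by rewrite dot0l.
rewrite psumr_eq0 => [/allP uu0|i _]; last by rewrite -expr2 sqr_ge0.
apply/rowP => i; rewrite mxE; apply/eqP.
by have := uu0 i (mem_index_enum _); rewrite mulf_eq0 orbb.
Qed.

Lemma dot_gt0 u : (0 < dot u u) = (u != 0).
Proof. by rewrite lt_def dot_eq0 dot_ge0 andbT. Qed.

Lemma dot_mulmx u v B : dot (u *m B) v = dot u (v *m B^T).
Proof. by rewrite !dotE trmx_mul trmxK mulmxA. Qed.

End Dot.

(** * Continuity and compactness in spaces of matrices *)

Section Topology.
Variable R : realType.

Lemma continuous_mx (T : topologicalType) m n (f : T -> 'M[R]_(m, n)) :
  (forall i j, continuous (fun t => f t i j)) -> continuous f.
Proof.
move=> cf t; apply/cvgrPdist_lt => e e0.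
have H : \forall s \near t, forall ij : 'I_m * 'I_n,
    `|f t ij.1 ij.2 - f s ij.1 ij.2| < e.
  apply: filter_forall => -[i j] /=.
  by have /cvgrPdist_lt/(_ _ e0) := cf i j t.
near=> s; rewrite [X in X < _]/Num.norm /= mx_normrE.
apply/bigmax_ltP; split => // ij _; rewrite !mxE.
by move: ij; near: s; exact: H.
Unshelve. all: by end_near. Qed.

Lemma continuous_coord (T : topologicalType) m n (f : T -> 'M[R]_(m, n)) i j :
  continuous f -> continuous (fun t => f t i j).
Proof.
move=> cf t.
apply: (@continuous_comp _ _ _ f (fun M : 'M[R]_(m, n) => M i j)).
  exact: cf.
exact: coord_continuous.
Qed.

Lemma continuous_addf (T : topologicalType) (V : normedModType R)
    (f g : T -> V) :
  continuous f -> continuous g -> continuous (fun t => f t + g t).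
Proof. by move=> cf cg t; apply: cvgD; [exact: cf|exact: cg]. Qed.

Lemma continuous_oppf (T : topologicalType) (V : normedModType R)
    (f : T -> V) : continuous f -> continuous (fun t => - f t).
Proof. by move=> cf t; apply: cvgN; exact: cf. Qed.

Lemma continuous_scalef (T : topologicalType) (V : normedModType R)
    (s : T -> R) (f : T -> V) :
  continuous s -> continuous f -> continuous (fun t => s t *: f t).
Proof. by move=> cs cf t; apply: cvgZ; [exact: cs|exact: cf]. Qed.

Lemma continuous_mulf (T : topologicalType) (f g : T -> R) :
  continuous f -> continuous g -> continuous (fun t => f t * g t).
Proof. by move=> cf cg t; apply: cvgM; [exact: cf|exact: cg]. Qed.

Lemma continuous_sumf (T : topologicalType) (I : Type) (r : seq I)
    (f : I -> T -> R) :
  (forall i, continuous (f i)) -> continuous (fun t => \sum_(i <- r) f i t).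
Proof.
move=> cf; apply: continuous_big => // -[x y].
by apply: cvgD; [exact: cvg_fst|exact: cvg_snd].
Qed.

Lemma continuous_mulmx (T : topologicalType) m n p (f : T -> 'M[R]_(m, n))
    (g : T -> 'M[R]_(n, p)) :
  continuous f -> continuous g -> continuous (fun t => f t *m g t).
Proof.
move=> cf cg; apply: continuous_mx => i j.
rewrite (_ : (fun t => _) = fun t => \sum_k f t i k * g t k j).
  by apply: continuous_sumf => k; apply: continuous_mulf; exact: continuous_coord.
by apply/funext => t; rewrite mxE.
Qed.

Lemma continuous_dot (T : topologicalType) n (f g : T -> 'rV[R]_n) :
  continuous f -> continuous g -> continuous (fun t => dot (f t) (g t)).
Proof.
move=> cf cg; apply: continuous_sumf => k.
by apply: continuous_mulf; exact: continuous_coord.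
Qed.

Lemma continuous_trmx (T : topologicalType) m n (f : T -> 'M[R]_(m, n)) :
  continuous f -> continuous (fun t => (f t)^T).
Proof.
move=> cf; apply: continuous_mx => i j.
rewrite (_ : (fun t => _) = fun t => f t j i); first exact: continuous_coord.
by apply/funext => t; rewrite mxE.
Qed.

Lemma continuous_idf (T : topologicalType) : continuous (fun t : T => t).
Proof. by move=> t; exact: cvg_id. Qed.

Lemma continuous_fstf (T U : topologicalType) : continuous (fun t : T * U => t.1).
Proof. by move=> t; exact: cvg_fst. Qed.

Lemma continuous_sndf (T U : topologicalType) : continuous (fun t : T * U => t.2).
Proof. by move=> t; exact: cvg_snd. Qed.

Lemma closed_eqf (T : topologicalType) (V : normedModType R) (f g : T -> V) :
  continuous f -> continuous g -> closed [set t | f t = g t].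
Proof.
move=> cf cg.
rewrite (_ : [set _ | _] = (fun t => f t - g t) @^-1` [set 0]).
  apply: preimage_closed => [t _|].
    by apply: cvgD; [exact: cf|apply: cvgN; exact: cg].
  by apply: accessible_closed_set1; apply: hausdorff_accessible;
    exact: norm_hausdorff.
apply/seteqP; split => t /= [fg].
  by apply/eqP; rewrite fg subrr.
by apply/eqP; rewrite -subr_eq0; apply/eqP.
Qed.

Lemma closed_lef (T : topologicalType) (f g : T -> R) :
  continuous f -> continuous g -> closed [set t | f t <= g t].
Proof.
move=> cf cg.
rewrite (_ : [set _ | _] = (fun t => g t - f t) @^-1` [set x | 0 <= x]).
  apply: preimage_closed => [t _|]; last exact: closed_ge.
  by apply: cvgD; [exact: cg|apply: cvgN; exact: cf].
by apply/seteqP; split => t /=; rewrite subr_ge0.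
Qed.

Lemma open_ltf (T : topologicalType) (f g : T -> R) :
  continuous f -> continuous g -> open [set t | f t < g t].
Proof.
move=> cf cg; rewrite -closedC (_ : ~` _ = [set t | g t <= f t]).
  exact: closed_lef.
by apply/seteqP; split => t /=; rewrite leNgt; [move/negP|move=> /negP].
Qed.

Lemma closed_preimage (T U : topologicalType) (f : T -> U) (A : set U) :
  continuous f -> closed A -> closed [set t | A (f t)].
Proof. by move=> cf; apply: preimage_closed => t _; exact: cf. Qed.

Lemma closed_forall (T : topologicalType) (I : Type) (P : I -> T -> Prop) :
  (forall i, closed [set t | P i t]) -> closed [set t | forall i, P i t].
Proof.
move=> cP; rewrite (_ : [set _ | _] = \bigcap_i [set t | P i t]).
  by apply: closed_bigI => i _; exact: cP.
by apply/seteqP; split => t /= H i; [move=> _|]; exact: H.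
Qed.

Lemma closed_imply (T : topologicalType) (Q : Prop) (P : T -> Prop) :
  closed [set t | P t] -> closed [set t | Q -> P t].
Proof. by move=> cP; apply: (@closed_forall _ Q (fun _ t => P t)). Qed.

Lemma closed_and (T : topologicalType) (P Q : T -> Prop) :
  closed [set t | P t] -> closed [set t | Q t] -> closed [set t | P t /\ Q t].
Proof. exact: closedI. Qed.

End Topology.

(** Continuity of expressions built from sums, products, transposes and inner
    products, by recursion on the body of the function; an eta-reduced function
    is expanded before its body is inspected. *)
Ltac cont_lam :=
  lazymatch goal with
  | |- continuous ?f =>
    lazymatch f with
    | (fun _ => ?c) => exact: cst_continuous
    | (fun t => t) => exact: continuous_idf
    | (fun t => fst t) => exact: continuous_fstf
    | (fun t => snd t) => exact: continuous_sndf
    | (fun t => dot _ _) => apply: continuous_dot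
    | (fun t => mulmx _ _) => apply: continuous_mulmx
    | (fun t => trmx _) => apply: continuous_trmx
    | (fun t => GRing.scale _ _) => apply: continuous_scalef
    | (fun t => GRing.mul _ _) => apply: continuous_mulf
    | (fun t => GRing.opp _) => apply: continuous_oppf
    | (fun t => GRing.add _ _) => apply: continuous_addf
    end
  end.

Ltac cont_step :=
  lazymatch goal with
  | H : continuous ?f |- continuous ?f => exact: H
  | |- continuous (fun _ => _) => cont_lam
  | |- continuous ?f => change (continuous (fun t => f t)); cont_lam
  end.

Ltac cont := solve [repeat cont_step].

(** * Compactness and circumcentres *)

Section Compactness.
Variable R : realType.

Lemma compact_seq_cluster (T : topologicalType) (X : set T) (u : nat -> T) :
  compact X -> (forall k, X (u k)) ->
  exists2 x, X x & forall U, nbhs x U -> forall N, exists2 k, (N <= k)%N & U (u k).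
Proof.
move=> cX Xu; have [|x [Xx clx]] := cX (u @ \oo) _.
  by exists 0%N => // k _; exact: Xu.
exists x => // U xU N.
have : (u @ \oo) (u @` [set k | (N <= k)%N]).
  by exists N => // k Nk; exists k.
by move=> /clx/(_ xU)[_ [[k Nk <-] Uk]]; exists k.
Qed.

Lemma compact_finite_cover (V : normedModType R) (X : set V) (N : V -> set V) :
  compact X -> (forall x, X x -> open (N x)) -> (forall x, X x -> N x x) ->
  exists2 L : seq V, (forall l, l \in L -> X l) &
    forall x, X x -> exists2 l, l \in L & N l x.
Proof.
move=> cX oN NN; move: cX; rewrite compact_cover => cX.
have [x Xx|D' sD cD] := cX V X N oN; first by exists x => //; exact: NN.
exists (finmap.enum_fset D') => [l /sD|x /cD[l lD]]; first by rewrite inE.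
by exists l.
Qed.

(** Where the open set sticks out of the first closed set, it is covered by the
    remaining ones. *)
Lemma interior_finite_closed_cover (T : topologicalType) (I : eqType)
    (L : seq I) (F : I -> set T) (V : set T) :
  (forall i, closed (F i)) -> open V -> V !=set0 ->
  (forall x, V x -> exists2 i, i \in L & F i x) ->
  exists2 i, i \in L & exists W, [/\ open W, W !=set0, W `<=` V & W `<=` F i].
Proof.
move=> cF; elim: L V => [|i L IH] V oV [x Vx] cov.
  by have [] := cov _ Vx.
have [VF|/existsNP[y /not_implyP[Vy nFy]]] := pselect (V `<=` F i).
  by exists i; [exact: mem_head|exists V; split => //; exists x].
have [|||j jL [W [oW W0 WV WF]]] := IH (V `&` ~` F i).
- by apply: openI => //; rewrite openC.
- by exists y.
- move=> z [Vz nFz]; have [j] := cov _ Vz.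
  by rewrite in_cons => /predU1P[->//|jL Fj]; exists j.
exists j; first by rewrite in_cons jL orbT.
by exists W; split => // z /WV[].
Qed.

(** Circumcentre argument: the worst case over [i] of functions [f i] that are
    uniformly strictly convex has exactly one minimiser on [X], and a map that
    only permutes the functions [f i] must preserve it. *)
Lemma minimax_fixed_point (V : normedModType R) (X : set V) (I : Type)
    (i0 : I) (f : I -> V -> R) :
  compact X ->
  (forall x y, X x -> X y -> X (2^-1 *: (x + y))) ->
  (forall i, continuous (f i)) ->
  (forall i x, 0 <= f i x) ->
  (exists2 x, X x & exists M, forall i, f i x <= M) ->
  (forall x y, X x -> X y -> x <> y -> exists2 c, 0 < c &
     forall i, f i (2^-1 *: (x + y)) <= (f i x + f i y) / 2 - c) ->
  exists2 x, X x & forall h : V -> V, (forall y, X y -> X (h y)) ->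
    (forall i, exists j, forall y, X y -> f i (h y) = f j y) -> h x = x.
Proof.
move=> cX midX cf f0 [x0 Xx0 [M fM]] strict.
pose E := [set t | exists2 x, X x & forall i, f i x <= t].
have lbE : has_lbound E.
  by exists 0 => t [x _ /(_ i0)]; exact: le_trans.
have infE : has_inf E by split => //; exists M, x0.
pose m := inf E.
have approx k : exists x, X x /\ forall i, f i x <= m + k.+1%:R^-1.
  have [|t [x Xx ft] tm] := @inf_adherent _ E k.+1%:R^-1 _ infE.
    by rewrite invr_gt0.
  by exists x; split => // i; apply: le_trans (ltW tm).
have [u uP] := choice approx.
have [|x Xx clx] := @compact_seq_cluster _ X u cX; first by move=> k; case: (uP k).
have fxm i : f i x <= m.
  apply/ler_addgt0Pr => e e0; rewrite leNgt; apply/negP => fxe.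
  have /clx : nbhs x [set y | m + e < f i y].
    apply: (cf i x [set y | m + e < y]); apply: open_nbhs_nbhs.
    by split => //; exact: open_gt.
  have [N Ne] : exists N, forall k, (N <= k)%N -> k.+1%:R^-1 <= e.
    have [N _ HN] := near_infty_natSinv_lt (PosNum e0).
    by exists N => k /HN /ltW.
  move=> /(_ N)[k /Ne ke /=]; apply/negP; rewrite -leNgt.
  by apply: le_trans ((uP k).2 i) _; rewrite lerD2l.
exists x => // h Xh fh; apply: contrapT => hx.
have [c c0 fc] := strict _ _ (Xh _ Xx) Xx hx.
have : E (m - c).
  exists (2^-1 *: (h x + x)); first by apply: midX => //; exact: Xh.
  move=> i; apply: le_trans (fc i) _.
  have [j fj] := fh i; rewrite (fj _ Xx).
  by have := fxm i; have := fxm j; lra.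
by move=> /(ge_inf lbE); rewrite -/m; lra.
Qed.

End Compactness.

(** * Quadratic forms *)

Section Forms.
Variables (R : realType) (n : nat).
Implicit Types (u v w x y : 'rV[R]_n) (A B : 'M[R]_n).

Definition bil B u v := dot (u *m B) v.

Definition posdef B := B^T = B /\ forall u, u != 0 -> 0 < bil B u u.

Lemma bilDl B u v w : bil B (u + v) w = bil B u w + bil B v w.
Proof. by rewrite /bil mulmxDl dotDl. Qed.

Lemma bilDr B u v w : bil B w (u + v) = bil B w u + bil B w v.
Proof. exact: dotDr. Qed.

Lemma bilNl B u w : bil B (- u) w = - bil B u w.
Proof. by rewrite /bil mulNmx dotNl. Qed.

Lemma bilNr B u w : bil B w (- u) = - bil B w u.
Proof. exact: dotNr. Qed.

Lemma bilZl B a u w : bil B (a *: u) w = a * bil B u w.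
Proof. by rewrite /bil -scalemxAl dotZl. Qed.

Lemma bilZr B a u w : bil B w (a *: u) = a * bil B w u.
Proof. exact: dotZr. Qed.

Definition bil_linE := (bilDl, bilDr, bilNl, bilNr, bilZl, bilZr).

Lemma bil0l B u : bil B 0 u = 0.
Proof. by rewrite /bil mul0mx dot0l. Qed.

Lemma bilC B u v : B^T = B -> bil B u v = bil B v u.
Proof. by move=> sB; rewrite /bil dot_mulmx sB dotC. Qed.

Lemma bil_congr A B u v : bil (A *m B *m A^T) u v = bil B (u *m A) (v *m A).
Proof. by rewrite /bil !mulmxA [RHS]dotC [RHS]dot_mulmx [RHS]dotC. Qed.

Lemma bil_ge0 B u : posdef B -> 0 <= bil B u u.
Proof.
by move=> [_ pB]; have [->|/pB/ltW//] := eqVneq u 0; rewrite bil0l.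
Qed.

Lemma bil_eq0 B u : posdef B -> bil B u u = 0 -> u = 0.
Proof.
by move=> [_ pB] u0; apply: contra_eq (u0) => /pB; rewrite lt0r => /andP[].
Qed.

End Forms.

Section Norm.
Variable R : realType.

Lemma coord_le_norm m n (M : 'M[R]_(m, n)) i j : `|M i j| <= `|M|.
Proof.
rewrite [leRHS]/Num.norm /= mx_normrE.
by apply/bigmax_geP; right; exists (i, j).
Qed.

Lemma norm_le_coord m n (M : 'M[R]_(m, n)) a : 0 <= a ->
  (forall i j, `|M i j| <= a) -> `|M| <= a.
Proof.
move=> a0 Ma; rewrite [leLHS]/Num.norm /= mx_normrE.
by apply/bigmax_leP.
Qed.

Lemma norm_mulmx m n p (M : 'M[R]_(m, n)) (N : 'M[R]_(n, p)) :
  `|M *m N| <= n%:R * (`|M| * `|N|).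
Proof.
apply: norm_le_coord => [|i j]; first by rewrite !mulr_ge0.
rewrite mxE; apply: le_trans (ler_norm_sum _ _ _) _.
rewrite -[n in n%:R]card_ord mulr_natl -sumr_const; apply: ler_sum => k _.
by rewrite normrM ler_pM // coord_le_norm.
Qed.

Lemma norm_trmx m n (M : 'M[R]_(m, n)) : `|M^T| = `|M|.
Proof.
apply/eqP; rewrite eq_le; apply/andP; split; apply: norm_le_coord => // i j.
  by rewrite mxE coord_le_norm.
by have := coord_le_norm M^T j i; rewrite mxE.
Qed.

Lemma norm_mxvec m n (M : 'M[R]_(m, n)) : `|mxvec M| = `|M|.
Proof.
apply/eqP; rewrite eq_le; apply/andP; split; apply: norm_le_coord => // i j.
  by rewrite ord1; case/mxvec_indexP: j => a b; rewrite mxvecE coord_le_norm.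
by rewrite -mxvecE coord_le_norm.
Qed.

Lemma norm_sqr_le_dot n (u : 'rV[R]_n) : `|u| ^+ 2 <= dot u u.
Proof.
rewrite -[leRHS]sqr_sqrtr ?dot_ge0// ler_sqr ?nnegrE ?sqrtr_ge0//.
apply: norm_le_coord => [|i j]; first exact: sqrtr_ge0.
rewrite ord1 -sqrtr_sqr ler_wsqrtr// /dot (bigD1 j)//= -expr2 lerDl.
by apply: sumr_ge0 => k _; rewrite -expr2 sqr_ge0.
Qed.

Lemma dot_le_norm_sqr n (u : 'rV[R]_n) : dot u u <= n%:R * `|u| ^+ 2.
Proof.
rewrite -[n in n%:R]card_ord mulr_natl -sumr_const; apply: ler_sum => k _.
rewrite -expr2 -real_normK ?num_real// ler_sqr ?nnegrE//.
exact: coord_le_norm.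
Qed.

Lemma bounded_closed_compact_mx m n (X : set 'M[R]_(m, n)) (M : R) :
  (forall A, X A -> `|A| <= M) -> closed X -> compact X.
Proof.
move=> XM cX.
have cvec : continuous (@vec_mx R m n).
  apply: continuous_mx => i j.
  rewrite (_ : (fun _ => _) = fun v : 'rV[R]_(m * n) => v 0 (mxvec_index i j)).
    exact: coord_continuous.
  by apply/funext => v; rewrite -{2}[v]vec_mxK mxvecE.
rewrite (_ : X = vec_mx @` [set v | X (vec_mx v)]); last first.
  apply/seteqP; split => [A XA|A [v Xv <-]//].
  by exists (mxvec A); rewrite /= ?mxvecK.
apply: continuous_compact; first exact: continuous_subspaceT.
apply: bounded_closed_compact; last exact: closed_preimage.
exists M; split; first exact: num_real.
move=> t Mt v /= /XM; rewrite -norm_mxvec vec_mxK => vM.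
exact: le_trans (ltW Mt).
Qed.

End Norm.

(** * Forms invariant under a bounded group *)

Section InvariantForm.
Variables (R : realType) (n : nat).
Implicit Types (u v w x y : 'rV[R]_n) (A B C : 'M[R]_n).

Let e (i : 'I_n) : 'rV[R]_n := delta_mx 0 i.

Let norm_e i : `|e i| <= 1.
Proof.
apply: norm_le_coord => // a b; rewrite mxE.
by case: (_ && _); rewrite ?normr1 ?normr0.
Qed.

Lemma bil_delta B i j : bil B (delta_mx 0 i) (delta_mx 0 j) = B i j.
Proof. by rewrite /bil dotE -rowE trmx_delta -colE !mxE. Qed.

(** Any family of linear bijections preserving a bounded neighbourhood [D] of
    [0] preserves a common positive definite form.  The forms pinched between
    the constraints below form a compact convex set on which these bijections
    act, and the squared Frobenius norm of [A *m B *m A^T], for [A] ranging over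
    them, is the family to which the circumcentre argument applies. *)
Lemma invariant_form (D : set 'rV[R]_n) (r1 r2 : R) :
  0 < r1 -> (forall x, `|x| < r1 -> D x) -> (forall x, D x -> `|x| <= r2) ->
  exists2 B, posdef B & forall A, A \in unitmx ->
    (forall x, D x <-> D (x *m A)) -> A *m B *m A^T = B.
Proof.
move=> r10 r1D Dr2.
have r20 : 0 <= r2.
  by apply: le_trans (Dr2 0 _); rewrite ?normr0//; apply: r1D; rewrite normr0.
have [n0|n0] := posnP n.
  exists 0; last by move=> A _ _; rewrite mulmx0 mul0mx.
  split; first by rewrite trmx0.
  by move=> u /eqP []; apply/rowP => -[i ilt]; exfalso; move: ilt; rewrite n0.
pose c := (n%:R * r2 ^+ 2 + 1)^-1.
have c0 : 0 < c.
  by rewrite invr_gt0 ltr_wpDl// mulr_ge0// sqr_ge0.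
pose eps := c * r1 ^+ 2.
have eps0 : 0 < eps by rewrite mulr_gt0// exprn_gt0.
pose X := [set B | [/\ B^T = B, forall x, D x -> bil B x x <= 1 &
                      forall x, ~ D x -> eps <= bil B x x]].
have posX B : X B -> posdef B.
  move=> [sB _ BD]; split => // u u0.
  have nu : 0 < `|u| by rewrite normr_gt0.
  pose t := (r2 + 1) / `|u|.
  have t0 : 0 < t by rewrite divr_gt0// ltr_wpDl.
  have : eps <= bil B (t *: u) (t *: u).
    apply: BD => /Dr2; apply/negP; rewrite -ltNge normrZ gtr0_norm//.
    by rewrite divfK ?gt_eqF// ltrDl.
  rewrite !bil_linE => /(lt_le_trans eps0).
  by rewrite !(pmulr_rgt0 _ t0).
have XB0 : X c%:M.
  have bc x : bil c%:M x x = c * dot x x by rewrite /bil mul_mx_scalar dotZl.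
  split; first by rewrite tr_scalar_mx.
    move=> x /Dr2 xr; rewrite bc /c mulrC ler_pdivrMr ?mul1r; last by rewrite -invr_gt0.
    apply: le_trans (dot_le_norm_sqr _) _; apply: le_trans (_ : n%:R * r2 ^+ 2 <= _).
      by rewrite ler_wpM2l// lerXn2r// nnegrE.
    by rewrite lerDl.
  move=> x nD; rewrite bc /eps ler_wpM2l ?(ltW c0)//.
  apply: le_trans (_ : `|x| ^+ 2 <= _); last exact: norm_sqr_le_dot.
  rewrite lerXn2r ?nnegrE ?(ltW r10)//.
  by rewrite leNgt; apply/negP => /r1D.
(* Short enough for [D] to contain [s *: (e i + e j)]. *)
pose s := r1 / 3.
have s0 : 0 < s by rewrite divr_gt0.
have De i : D (s *: e i).
  apply: r1D; rewrite normrZ gtr0_norm//.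
  apply: le_lt_trans (_ : s * 1 < _); first by rewrite ler_wpM2l ?(ltW s0).
  by rewrite /s; lra.
have Dee i j : D (s *: (e i + e j)).
  apply: r1D; rewrite normrZ gtr0_norm//.
  apply: le_lt_trans (_ : s * (1 + 1) < _).
    by rewrite ler_wpM2l ?(ltW s0)//; apply: le_trans (ler_normD _ _) _; rewrite lerD.
  by rewrite /s; lra.
have Xbound B : X B -> `|B| <= (s ^+ 2)^-1.
  move=> XB; have [sB BD _] := XB.
  apply: norm_le_coord => [|i j]; first by rewrite invr_ge0 exprn_ge0 ?ltW.
  have := BD _ (Dee i j); have := BD _ (De i); have := BD _ (De j).
  have := bil_ge0 (e i + e j) (posX _ XB); have := bil_ge0 (e i) (posX _ XB).
  have := bil_ge0 (e j) (posX _ XB).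
  rewrite !bil_linE -!mulrDr !bil_delta.
  have -> : B j i = B i j by rewrite -{1}sB mxE.
  have s20 : 0 < s * s by rewrite mulr_gt0.
  have scale a : (s * (s * a) <= 1) = (a <= (s ^+ 2)^-1).
    by rewrite mulrA -ler_pdivlMl// mulr1 expr2.
  rewrite !scale ler_norml => H1 H2 H3 H4 H5 H6; apply/andP; split; lra.
have cX : compact X.
  apply: bounded_closed_compact_mx Xbound _.
  rewrite (_ : X = [set B | B^T = B] `&` ([set B | forall x, D x -> bil B x x <= 1]
      `&` [set B | forall x, ~ D x -> eps <= bil B x x])); last first.
    by apply/seteqP; split => [B []|B [? []]].
  apply: closedI; first by apply: closed_eqf; cont.
  apply: closedI; apply: closed_forall => x; apply: closed_imply;
    by apply: closed_lef; rewrite /bil; cont.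
pose H := {A : 'M[R]_n | A \in unitmx /\ forall x, D x <-> D (x *m A)}.
have H1 : H.
  by exists 1%:M; split; [exact: unitmx1|move=> x; rewrite mulmx1].
pose act A B : 'rV[R]_(n * n) := mxvec (A *m B *m A^T).
pose f (h : H) B := dot (act (projT1 h) B) (act (projT1 h) B).
have HX (h : H) B : X B -> X (projT1 h *m B *m (projT1 h)^T).
  case: h => A /= [_ AD] [sB B1 B2]; split => [|x Dx|x nDx].
  - by rewrite !trmx_mul trmxK sB mulmxA.
  - by rewrite bil_congr; apply: B1; exact: (AD x).1.
  - by rewrite bil_congr; apply: B2; apply: contra_not nDx; exact: (AD x).2.
pose M := r2 / s.
have HM (h : H) : `|projT1 h| <= M.
  case: h => A /= [_ AD].
  apply: norm_le_coord => [|i j]; first by rewrite divr_ge0// ltW.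
  rewrite /M ler_pdivlMr// mulrC -[X in X * _]gtr0_norm// -normrM.
  have : `|s *: e i *m A| <= r2 by apply: Dr2; apply: (AD _).1.
  apply: le_trans; apply: le_trans (coord_le_norm _ 0 j).
  by rewrite -scalemxAl -rowE !mxE.
have M0 : 0 <= M by apply: divr_ge0 => //; exact: ltW.
clearbody M.
pose N := n%:R * ((n%:R * M) * M) + 1.
have N0 : 0 < N by apply: ltr_wpDl => //; rewrite !mulr_ge0.
have actN A C : `|A| <= M -> `|A *m C *m A^T| <= N * `|C|.
  move=> AM; apply: le_trans (norm_mulmx _ _) _; rewrite norm_trmx.
  apply: le_trans (_ : n%:R * (n%:R * (M * `|C|) * M) <= _); last first.
    have C0 := normr_ge0 C; rewrite /N mulrDl mul1r.
    by rewrite (_ : n%:R * _ = n%:R * (n%:R * M * M) * `|C|); [lra|ring].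
  rewrite ler_wpM2l//.
  apply: ler_pM => //; apply: le_trans (norm_mulmx _ _) _.
  by rewrite ler_wpM2l// ler_wpM2r.
have Hinv A : A \in unitmx /\ (forall x, D x <-> D (x *m A)) ->
    `|invmx A| <= M.
  move=> [uA AD].
  suff h : invmx A \in unitmx /\ forall x, D x <-> D (x *m invmx A).
    exact: (HM (exist _ _ h)).
  split; first by rewrite unitmx_inv.
  by move=> x; split => [Dx|/(AD _).1]; [apply: (AD _).2|]; rewrite mulmxKV.
have [||h B||B1 B2 XB1 XB2 neqB|B XB fixB] :=
    @minimax_fixed_point R _ X H H1 f cX.
- move=> B B' [sB B1 B2] [sB' B1' B2']; split => [|x Dx|x Dx].
  + by rewrite linearZ/= linearD/= sB sB'.
  + rewrite /bil -scalemxAr mulmxDr dotZl dotDl.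
    by have := B1 _ Dx; have := B1' _ Dx; rewrite /bil; lra.
  + rewrite /bil -scalemxAr mulmxDr dotZl dotDl.
    by have := B2 _ Dx; have := B2' _ Dx; rewrite /bil; lra.
- move=> h; rewrite /f /act.
  suff cm : continuous (fun B => mxvec (projT1 h *m B *m (projT1 h)^T)) by cont.
  apply: continuous_mx => i j; rewrite ord1; case/mxvec_indexP: j => a b.
  under [fun _ => _]funext do rewrite mxvecE.
  by apply: continuous_coord; cont.
- exact: dot_ge0.
- exists c%:M => //.
  exists ((n * n)%:R * (N * `|c%:M : 'M[R]_n|) ^+ 2) => h.
  apply: le_trans (dot_le_norm_sqr _) _; rewrite ler_wpM2l// norm_mxvec.
  by rewrite lerXn2r ?nnegrE ?mulr_ge0 ?(ltW N0)// actN.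
- pose C := B1 - B2.
  have C0 : 0 < `|C|.
    by rewrite normr_gt0 subr_eq0; apply/eqP.
  exists ((`|C| / N) ^+ 2 / 4); first by rewrite divr_gt0// exprn_gt0// divr_gt0.
  move=> h; rewrite /f.
  have -> : act (projT1 h) (2^-1 *: (B1 + B2)) =
      2^-1 *: (act (projT1 h) B1 + act (projT1 h) B2).
    by rewrite /act -scalemxAr -scalemxAl mulmxDr mulmxDl linearZ/= linearD.
  have : (`|C| / N) ^+ 2 <= dot (act (projT1 h) C) (act (projT1 h) C).
    apply: le_trans (norm_sqr_le_dot _); rewrite norm_mxvec.
    rewrite lerXn2r ?nnegrE ?divr_ge0 ?(ltW N0)// ler_pdivrMr// mulrC.
    have [uA AD] := projT2 h.
    have {1}-> : C = invmx (projT1 h) *m (projT1 h *m C *m (projT1 h)^T)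
                   *m (invmx (projT1 h))^T.
      by rewrite trmx_inv !mulmxA mulVmx// mul1mx mulmxK// unitmx_tr.
    by apply: actN; apply: Hinv.
  have -> : act (projT1 h) C = act (projT1 h) B1 - act (projT1 h) B2.
    by rewrite /act /C mulmxBr mulmxBl linearB.
  rewrite !dot_linE (dotC (act _ B2) (act _ B1)).
  by lra.
- exists B; first exact: posX.
  move=> A uA AD; apply: (fixB (fun B => A *m B *m A^T)) => [B' XB'|h].
    exact: (HX (exist _ A (conj uA AD))).
  have hA : projT1 h *m A \in unitmx /\
      forall x, D x <-> D (x *m (projT1 h *m A)).
    have [uh hD] := projT2 h; split; first by rewrite unitmx_mul uh.
    by move=> x; rewrite mulmxA -AD.
  pose hA' : H := exist _ (projT1 h *m A) hA.
  exists hA' => B' _.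
  by rewrite /f /act /= trmx_mul !mulmxA.
Qed.

End InvariantForm.

(** * The invariant Euclidean structure of a convex body *)

Section InvariantStructure.
Variables (R : realType) (n : nat).
Implicit Types (u v w x y : 'rV[R]_n) (A B C : 'M[R]_n) (K : set 'rV[R]_n).

Lemma convex_setP K (t : R) x y : convex_set K -> K x -> K y ->
  0 <= t <= 1 -> K (t *: x + (1 - t) *: y).
Proof.
move=> cK Kx Ky /andP[t0 t1].
have := cK x y (Itv01 t0 t1) (mem_set Kx) (mem_set Ky).
by rewrite inE.
Qed.

(** The linear parts of the symmetries of [K] preserve the difference body
    [K - K], a bounded neighbourhood of [0]; this gives [B].  The symmetries are
    then isometries for [B], and fix the [B]-circumcentre [x0] of [K]. *)
Lemma invariant_structure K : convex_body K ->
  exists B x0, posdef B /\ forall A b, A \in unitmx ->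
    (fun x => x *m A + b) @` K = K -> A *m B *m A^T = B /\ x0 *m A + b = x0.
Proof.
move=> [cK convK [k0 k0int]].
have Kk0 : K k0 by exact: interior_subset.
pose D := [set x | exists y z, [/\ K y, K z & x = y - z]].
have [r1 /= r10 r1K] : exists2 r : R, 0 < r & forall x, `|x| < r -> K (k0 + x).
  have /nbhs_ballP[r /= r0 rK] := k0int.
  exists r => // x xr; apply: rK; rewrite -ball_normE /=.
  by rewrite opprD addNKr normrN.
have [M [_ Mb]] := compact_bounded cK.
have KM x : K x -> `|x| <= M + 1 by apply: Mb; rewrite ltrDl.
have r1D x : `|x| < r1 -> D x.
  by move=> xr; exists (k0 + x), k0; split => //; [exact: r1K|rewrite addrC addKr].
have DM x : D x -> `|x| <= (M + 1) + (M + 1).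
  move=> [y [z [/KM Ky /KM Kz ->]]].
  by apply: le_trans (ler_normB _ _) _; exact: lerD.
have [B pB fixB] := invariant_form r10 r1D DM.
have sB := pB.1.
have KB : exists M', forall y : {y | K y}, bil B (k0 - projT1 y) (k0 - projT1 y) <= M'.
  have [|y _ ymax] := @compact_EVT_max _ R
      (fun y : 'rV[R]_n => bil B (k0 - y) (k0 - y)) K (ex_intro _ _ Kk0) cK.
    by apply: continuous_subspaceT; rewrite /bil; cont.
  by exists (bil B (k0 - y) (k0 - y)) => -[z Kz] /=; apply: ymax; exact: mem_set.
have [|y|y x||x1 x2 _ _ x12|x0 Kx0 fixx0] := @minimax_fixed_point R _ K {y | K y}
    (exist _ k0 Kk0) (fun k x => bil B (x - projT1 k) (x - projT1 k)) cK.
- move=> x y Kx Ky; rewrite scalerDr.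
  have -> : 2^-1 *: y = (1 - 2^-1) *: y by congr (_ *: _); field.
  by apply: convex_setP => //; apply/andP; split; lra.
- by rewrite /bil; cont.
- exact: bil_ge0.
- by exists k0.
- exists (bil B (x1 - x2) (x1 - x2) / 4).
    by rewrite divr_gt0// pB.2// subr_eq0; apply/eqP.
  move=> [y Ky] /=; rewrite !bil_linE (bilC x2 x1 sB) (bilC y x1 sB) (bilC y x2 sB).
  by rewrite -subr_ge0 le_eqVlt; apply/orP; left; apply/eqP; field.
exists B, x0; split => // A b uA AK.
have KA x : K x -> K (x *m A + b) by move=> Kx; rewrite -AK; exists x.
have AB : A *m B *m A^T = B.
  apply: fixB => // x; split => [[y [z [Ky Kz ->]]]|[y [z []]]].
    exists (y *m A + b), (z *m A + b); split; try exact: KA.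
    by rewrite mulmxBl opprD addrACA subrr addr0.
  rewrite -{1}AK => -[y' Ky' <-]; rewrite -{1}AK => -[z' Kz' <-].
  rewrite opprD addrACA subrr addr0 -mulmxBl => /(can_inj (mulmxK uA)) ->.
  by exists y', z'.
split => //; apply: (fixx0 (fun x => x *m A + b)) => // -[y Ky] /=.
have [y' Ky' yE] : exists2 y', K y' & y' *m A + b = y.
  by move: Ky; rewrite -{1}AK.
exists (exist _ y' Ky') => x _ /=.
by rewrite -yE opprD addrACA subrr addr0 -mulmxBl -bil_congr AB.
Qed.

Lemma exists_normal (W : {vspace 'rV[R]_n}) : (\dim W < n)%N ->
  exists2 f, f != 0 & forall x, x \in W -> dot x f = 0.
Proof.
move=> dW; pose A := \matrix_(i < \dim W) (vbasis W)`_i.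
have : kermx A^T != 0.
  rewrite -mxrank_eq0 mxrank_ker subn_eq0 -ltnNge.
  by apply: leq_ltn_trans dW; exact: rank_leq_col.
case/rowV0Pn => f /sub_kermxP fA f0; exists f => // x.
move/coord_vbasis ->; rewrite dotC.
have fW (i : 'I_(\dim W)) : dot f (vbasis W)`_i = 0.
  have /rowP/(_ i) := fA; rewrite !mxE => <-.
  by apply: eq_bigr => k _; rewrite !mxE.
elim/big_ind: _ => [|a b fa fb|i _]; first by rewrite dot0r.
  by rewrite dotDr fa fb addr0.
by rewrite dotZr fW mulr0.
Qed.

Lemma hyperplane_orthE (W : {vspace 'rV[R]_n}) f : (\dim W).+1 = n -> f != 0 ->
  (forall x, x \in W -> dot x f = 0) -> forall x, (x \in W) = (dot x f == 0).
Proof.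
move=> dW f0 Wf x; apply/idP/eqP => [/Wf//|xf]; apply: contraT => xW.
have : f \in (W + <[x]>)%VS.
  suff -> : (W + <[x]>)%VS = fullv by exact: memvf.
  apply/eqP; rewrite eqEdim subvf dimvf /dim /= mul1n -{1}dW ltn_neqAle.
  have [-> ->] := dimv_leqif_sup (addvSl W <[x]>).
  rewrite andbT; apply: contra xW => /subvP; apply.
  by have := memv_add (mem0v W) (memv_line x); rewrite add0r.
case/memv_addP => w Ww [_ /vlineP[k ->] fE].
by move: f0; rewrite -dot_eq0 {1}fE dotDl dotZl xf mulr0 addr0 Wf ?eqxx.
Qed.

Lemma hyperplane_normal (W : {vspace 'rV[R]_n}) : (\dim W).+1 = n ->
  exists2 f, f != 0 & forall x, (x \in W) = (dot x f == 0).
Proof.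
move=> dW; have [|f f0 Wf] := @exists_normal W; first by rewrite -ltnS dW.
by exists f => // x; apply: hyperplane_orthE.
Qed.

(** The definition of a reflection is pointwise; this formula shows that it is
    an affine map. *)
Lemma reflectionE (r : 'rV[R]_n -> 'rV[R]_n) (M : set 'rV[R]_n)
    (l : {vspace 'rV[R]_n}) : reflection r M l ->
  exists p v f, [/\ l = <[v]>%VS, dot v f = 1,
    forall x, M x <-> dot (x - p) f = 0 &
    forall x, r x = x - (2 * dot (x - p) f) *: v].
Proof.
move=> [p [W [-> dW dl lW rE]]].
have [f0 f0n f0W] := hyperplane_normal dW.
pose v0 := vpick l.
have v0n : v0 != 0 by rewrite vpick0 -dimv_eq0 dl.
have lE : l = <[v0]>%VS.
  apply/eqP; rewrite eq_sym eqEdim dl dim_vline v0n andbT.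
  by apply/subvP => _ /vlineP[k ->]; rewrite memvZ ?memv_pick.
have fv0 : dot v0 f0 != 0.
  by rewrite -f0W; apply: contra lW => v0W; rewrite lE; exact: v0W.
pose f := (dot v0 f0)^-1 *: f0.
have fv : dot v0 f = 1 by rewrite dotZr mulVf.
have fW x : x \in W <-> dot x f = 0.
  rewrite f0W dotZr; split => [/eqP->|/eqP]; first by rewrite mulr0.
  by rewrite mulf_eq0 invr_eq0 (negbTE fv0).
exists p, v0, f; split => // [x|x]; first exact: fW.
pose t := dot (x - p) f.
have xE : x = (x - t *: v0) + t *: v0 by rewrite subrK.
rewrite {1}xE rE; last 2 first.
- by apply/fW; rewrite addrAC dotDl dotNl dotZl fv mulr1 subrr.
- by rewrite lE memvZ ?memv_line.
by rewrite -/t -addrA -opprD -scalerDl mulr_natl mulr2n.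
Qed.

(** A polynomial way to say that [u], orthogonal to [g], has [u *m B] in the span
    of [u] and [g], in other words that [u] is an eigenvector of the compression
    of [B] to the hyperplane normal to [g]; in this form the condition is visibly
    closed. *)
Definition compressed_eigen B g u :=
  dot u g = 0 /\ (dot u u * dot g g) *: (u *m B) =
    (dot g g * bil B u u) *: u + (dot u u * bil B u g) *: g.

Definition symmetric_in B K u := forall x, K x -> K (x - (2 * bil B x u) *: u).

(** A linear form that vanishes on the common kernel of two others is a
    combination of them. *)
Lemma compressed_eigenP B g u : u != 0 -> g != 0 -> dot u g = 0 ->
  posdef B -> (forall w, dot w g = 0 -> bil B w u = 0 -> dot w u = 0) ->
  compressed_eigen B g u.
Proof.
move=> u0 g0 ug pB H; split => //.
have gg : 0 < dot g g by rewrite dot_gt0.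
have uu : 0 < dot u u by rewrite dot_gt0.
have bu := pB.2 _ u0.
pose h := (dot u u * dot g g) *: (u *m B) -
  ((dot g g * bil B u u) *: u + (dot u u * bil B u g) *: g).
have hE : h = (dot u u * dot g g) *: (u *m B) -
  ((dot g g * bil B u u) *: u + (dot u u * bil B u g) *: g) by [].
have hg : dot h g = 0.
  by rewrite hE !dot_linE ug /bil; ring.
have hu : dot h u = 0.
  by rewrite hE !dot_linE (dotC g u) ug /bil; ring.
suff : h = 0 by rewrite hE => /eqP; rewrite subr_eq0 => /eqP.
clearbody h; apply/eqP; rewrite -dot_eq0.
pose t := bil B h u / bil B u u.
have : dot (h - t *: u) u = 0.
  apply: H; first by rewrite !dot_linE hg ug; ring.
  by rewrite !bil_linE divfK ?gt_eqF// subrr.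
rewrite !dot_linE hu sub0r => /eqP; rewrite oppr_eq0 mulf_eq0 (gt_eqF uu) orbF.
rewrite mulf_eq0 invr_eq0 (gt_eqF bu) orbF => /eqP hBu.
have hB : dot h (u *m B) = 0 by rewrite dotC -[LHS]/(bil B u h) bilC ?pB.1.
by rewrite {2}hE !dot_linE hB (dotC h u) -(dotC h) hu hg; apply/eqP; ring.
Qed.

(** A reflection that preserves [B] and fixes [x0] is the [B]-orthogonal
    reflection through [x0] in its direction [u].  The mirror therefore meets the
    ground hyperplane in vectors that are [B]-orthogonal to [u], and these must be
    orthogonal to [u] as well. *)
Lemma strong_bezdek_direction B x0 K (G : {vspace 'rV[R]_n}) g :
  posdef B -> (forall A b, A \in unitmx ->
    (fun x => x *m A + b) @` K = K -> A *m B *m A^T = B /\ x0 *m A + b = x0) ->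
  strong_bezdek K G -> g != 0 -> (forall x, x \in G <-> dot x g = 0) ->
  exists2 u, bil B u u = 1 & compressed_eigen B g u /\
    symmetric_in B [set x | K (x0 + x)] u.
Proof.
move=> pB inv [r [rK [M [l [rl dG lG orth]]]]] g0 Gg.
have [p [v [f [lE vf Mf rE]]]] := reflectionE rl.
have vG : v \in G by move/subvP: lG; apply; rewrite lE memv_line.
have v0 : v != 0 by apply/eqP => v0; move: vf; rewrite v0 dot0l => /esym/eqP; rewrite oner_eq0.
have vg : dot v g = 0 by apply/Gg.
pose A : 'M[R]_n := 1%:M - 2 *: (f^T *m v).
have AE x : x *m A = x - (2 * dot x f) *: v.
  rewrite mulmxBr mulmx1 -scalemxAr mulmxA [x *m f^T]mx11_scalar -dotE mul_scalar_mx.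
  by rewrite scalerA.
have uA : A \in unitmx.
  suff AA : A *m A = 1%:M by have [] := mulmx1_unit AA.
  have AAx x : x *m A *m A = x.
    rewrite !AE !dot_linE vf -addrA -opprD -scalerDl.
    by rewrite (_ : 2 * _ + 2 * _ = 0) ?scale0r ?subr0//; ring.
  by apply/row_matrixP => i; rewrite !rowE mulmxA mulmx1 AAx.
pose b := (2 * dot p f) *: v.
have rAb : r = fun x => x *m A + b.
  apply/funext => x; rewrite rE AE /b dotDl dotNl mulrDr scalerDl mulrN.
  by rewrite scaleNr opprD opprK addrA.
have [AB x0A] := inv A b uA (etrans (congr1 (fun h => h @` K) (esym rAb)) rK).
have x0p : dot (x0 - p) f = 0.
  have := rE x0; rewrite rAb x0A => /eqP.
  rewrite -subr_eq0 opprB addrC subrK scaler_eq0 (negbTE v0) orbF mulf_eq0.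
  by rewrite pnatr_eq0 /= => /eqP.
have bv := pB.2 _ v0.
have vA : v *m A = - v.
  by rewrite AE vf mulr1 -{1}[v]scale1r -scalerBl (_ : 1 - 2 = -1) ?scaleN1r//; ring.
have wA w : dot w f = 0 -> bil B w v = 0.
  move=> wf; have := bil_congr A B w v.
  rewrite AB vA AE wf mulr0 scale0r subr0 bilNr => /eqP.
  by rewrite -subr_eq0 opprK -mulr2n mulrn_eq0 => /eqP.
have bf x : bil B x v = dot x f * bil B v v.
  have := wA (x - dot x f *: v); rewrite !dot_linE vf mulr1 subrr => /(_ erefl).
  by rewrite !bil_linE => /eqP; rewrite subr_eq0 => /eqP.
pose s := (Num.sqrt (bil B v v))^-1.
have s0 : 0 < s by rewrite invr_gt0 sqrtr_gt0.
have ss : s * s * bil B v v = 1.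
  by rewrite -invfM -expr2 sqr_sqrtr ?ltW// mulVf ?gt_eqF.
exists (s *: v); first by rewrite !bil_linE mulrA.
split; last first.
  move=> x /=; rewrite -{2}rK => Kx.
  exists (x0 + x) => //; rewrite rE -addrA; congr (_ + _).
  rewrite addrAC dotDl x0p add0r bilZr bf scalerA; congr (_ - _ *: _).
  by rewrite -[LHS]mulr1 -ss; ring.
apply: compressed_eigenP => //.
- by rewrite scaler_eq0 negb_or v0 gt_eqF.
- by rewrite dotZl vg mulr0.
move=> w wg; rewrite bilZr => /eqP; rewrite mulf_eq0 (gt_eqF s0) /= bf mulf_eq0.
rewrite (gt_eqF bv) orbF => /eqP wf.
pose m := dot p f *: v.
have mG : m \in G by rewrite memvZ.
have mM : M m by apply/Mf; rewrite dotDl dotNl dotZl vf mulr1 subrr.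
have mwM : M (m + w) by apply/Mf; rewrite addrAC dotDl wf addr0; apply/Mf.
have := orth (m + w) m v mwM mM; rewrite addrAC subrr add0r dotZr => ->.
- by rewrite mulr0.
- by rewrite memvD//; apply/Gg.
- by [].
- by rewrite lE memv_line.
Qed.

End InvariantStructure.

(** * Open sets of hyperplanes and their normals *)

Section Normals.
Variables (R : realType) (n : nat).
Implicit Types (g x : 'rV[R]_n) (A : 'M[R]_(n.-1, n)).

Lemma nth_rows A (i : 'I_n.-1) : (rows A)`_i = row i A.
Proof. by rewrite (nth_map i) ?size_enum_ord// nth_ord_enum. Qed.

Lemma stiefelP A : (forall c : 'rV[R]_n.-1, c *m A = 0 -> c = 0) -> stiefel A.
Proof.
move=> A0; apply: (introT (@freeP _ _ _ (rows A))) => k kA i.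
have : (\row_j k j) *m A = 0.
  rewrite mulmx_sum_row -[RHS]kA.
  by apply: eq_bigr => j _; rewrite mxE; congr (_ *: _); exact/esym/nth_rows.
by move/A0/rowP/(_ i); rewrite !mxE.
Qed.

(** Projecting a fixed frame of the hyperplane normal to [g0] orthogonally to
    [g] gives a frame of the hyperplane normal to [g], as long as [g] is not
    orthogonal to [g0]; the factor [dot g g] spares a division. *)
Lemma open_normals (U : set (grassmannian R n.-1 n)) : (0 < n)%N ->
  open U -> U !=set0 ->
  exists V : set 'rV[R]_n, [/\ open V, V !=set0 & forall g, V g ->
    g != 0 /\ exists2 G, U G & forall x, x \in val G <-> dot x g = 0].
Proof.
move=> n0 oU [W0 UW0]; pose W := val W0.
have dW : \dim W = n.-1 by exact/eqP/(valP W0).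
have dW1 : (\dim W).+1 = n by rewrite dW prednK.
have [g0 g0n Wg0] := hyperplane_normal dW1.
pose A0 : 'M[R]_(n.-1, n) := \matrix_(i < n.-1) (vbasis W)`_i.
have rowA0 i : row i A0 = (vbasis W)`_i by rewrite rowK.
pose F g : 'M[R]_(n.-1, n) := dot g g *: A0 - (A0 *m g^T) *m g.
have mulF (c : 'rV[R]_n.-1) g :
    c *m F g = dot g g *: (c *m A0) - dot (c *m A0) g *: g.
  by rewrite mulmxBr -scalemxAr 2!mulmxA [c *m A0 *m _]mx11_scalar -dotE mul_scalar_mx.
have WA0 c : c *m A0 \in W.
  rewrite mulmx_sum_row; apply: memv_suml => i _; rewrite memvZ// rowA0.
  by apply/vbasis_mem/mem_nth; rewrite size_tuple dW.
have A0free (c : 'rV[R]_n.-1) : c *m A0 = 0 -> c = 0.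
  rewrite mulmx_sum_row => cA0; apply/rowP => i; rewrite mxE.
  have fW := basis_free (vbasisP W).
  have /freeP/(_ (fun i => c 0 (cast_ord dW i))) := fW.
  move=> /(_ _ (cast_ord (esym dW) i)); rewrite cast_ordKV; apply.
  rewrite -[RHS]cA0 (reindex (cast_ord dW)) /=; last first.
    by apply: onW_bij; exists (cast_ord (esym dW)); [exact: cast_ordK|exact: cast_ordKV].
  by apply: eq_bigr => j _; rewrite rowA0.
have Ffree g : dot g g0 != 0 -> stiefel (F g).
  move=> gg0; apply: stiefelP => k kF.
  apply: A0free; set y := k *m A0.
  have gn0 : dot g g != 0 by rewrite dot_eq0; apply: contraNneq gg0 => ->; rewrite dot0l.
  have yW : dot y g0 = 0 by apply/eqP; rewrite -Wg0 WA0.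
  have yF : dot g g *: y - dot y g *: g = 0 by rewrite -mulF kF.
  have := congr1 (fun z => dot z g0) yF; rewrite !dot_linE yW mulr0 sub0r dot0l => /eqP.
  rewrite oppr_eq0 mulf_eq0 (negbTE gg0) orbF => /eqP yg.
  move/eqP: yF; rewrite yg scale0r subr0 scaler_eq0 (negbTE gn0) /=.
  by move/eqP.
have rowF g i : dot (row i (F g)) g = 0.
  by rewrite rowE mulF !dot_linE; ring.
have span_orth g x : x \in <<rows (F g)>>%VS -> dot x g = 0.
  move/coord_span ->; elim/big_ind: _ => [|a b ag bg|i _]; first by rewrite dot0l.
    by rewrite dotDl ag bg addr0.
  rewrite dotZl -[RHS](mulr0 (coord (rows (F g)) i x)) -(rowF g i).
  by congr (_ * dot _ _); exact: nth_rows.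
have cF : continuous F by rewrite /F; cont.
have /open_subspaceP[Q oQ QU] : grassmannian_open U by [].
have inO g : dot g g0 != 0 -> Q (F g) -> exists2 G, U G & val G = <<rows (F g)>>%VS.
  move=> /Ffree sg Qg.
  have : (Q `&` @stiefel R n.-1 n) (F g) by [].
  by rewrite QU => -[[G UG GE] _]; exists G.
exists ([set g | dot g g0 != 0] `&` [set g | Q (F g)]); split.
- apply: openI; last by apply: (@open_comp _ _ F Q) => // x _; exact: cF.
  rewrite -closedC (_ : ~` _ = [set g | dot g g0 = 0]).
    by apply: closed_eqf; cont.
  by apply/seteqP; split => g /=; [move/negP; rewrite negbK => /eqP|move=> ->; rewrite eqxx].
- exists g0; split => /=; first by rewrite dot_eq0.
  have sF := Ffree g0; rewrite dot_eq0 in sF.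
  suff : (Q `&` @stiefel R n.-1 n) (F g0) by case.
  rewrite QU; split; last exact: sF.
  exists W0 => //; apply/esym/eqP; rewrite eqEdim.
  have := sF g0n; rewrite /stiefel /= /free => /eqP ->.
  rewrite size_tuple dW card_ord leqnn andbT; apply/subvP => x /span_orth xg.
  by rewrite Wg0 xg.
move=> g [gg0 Qg].
have gn0 : g != 0 by apply: contraNneq gg0 => ->; rewrite dot0l.
split => //; have [G UG GE] := inO g gg0 Qg; exists G => // x.
rewrite (@hyperplane_orthE R n (val G) g) //.
- by split => /eqP.
- by rewrite (eqP (valP G)) prednK.
- by move=> y; rewrite GE; exact: span_orth.
Qed.

End Normals.

(** * Mirror directions *)

Section Mirrors.
Variables (R : realType) (n : nat) (B : 'M[R]_n).
Hypothesis pB : posdef B.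
Implicit Types (u v w x y : 'rV[R]_n) (K : set 'rV[R]_n).

Let sB := pB.1.

Lemma posdef_norm : exists2 c, 0 < c & forall x, c * `|x| ^+ 2 <= bil B x x.
Proof.
pose S := [set x : 'rV[R]_n | `|x| = 1].
have [S0|nS] := pselect (S !=set0); last first.
  exists 1 => // x; have [->|x0] := eqVneq x 0; first by rewrite bil0l normr0 expr0n mulr0.
  exfalso; apply: nS; exists (`|x|^-1 *: x).
  by rewrite /S /= normrZ normfV normr_id mulVf// normr_eq0.
have cS : compact S.
  apply: bounded_closed_compact.
    by exists 1; split; [exact: num_real|move=> M M1 x /= ->; exact: ltW].
  apply: (@closed_eqf R _ R (fun x : 'rV[R]_n => `|x|) (fun=> 1)).
    exact: norm_continuous.
  exact: cst_continuous.
have [|y /set_mem y1 ymin] := @compact_EVT_min _ R (fun x => bil B x x) S S0 cS.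
  by apply: continuous_subspaceT; rewrite /bil; cont.
have y0 : y != 0 by rewrite -normr_gt0 y1.
exists (bil B y y); first exact: pB.2.
move=> x; have [->|x0] := eqVneq x 0; first by rewrite bil0l normr0 expr0n mulr0.
have nx : 0 < `|x| by rewrite normr_gt0.
have : bil B y y <= bil B (`|x|^-1 *: x) (`|x|^-1 *: x).
  by apply: ymin; apply/mem_set; rewrite /S /= normrZ normfV normr_id mulVf// gt_eqF.
by rewrite !bil_linE mulrA -expr2 exprVn mulrC ler_pdivlMr// exprn_gt0.
Qed.

Definition mirror_dirs K : set 'rV[R]_n :=
  [set u | bil B u u = 1 /\ symmetric_in B K u].

Lemma closed_mirror_dirs K : closed K -> closed (mirror_dirs K).
Proof.
move=> cK; apply: closed_and.
  by apply: closed_eqf; rewrite /bil; cont.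
apply: closed_forall => x; apply: closed_imply.
apply: (@closed_preimage _ _ (fun u => x - (2 * bil B x u) *: u) K) => //.
by rewrite /bil; cont.
Qed.

Lemma compact_bil_sphere : compact [set u | bil B u u = 1].
Proof.
have [c c0 cle] := posdef_norm.
apply: bounded_closed_compact; last by apply: closed_eqf; rewrite /bil; cont.
exists (c^-1 + 1); split; first exact: num_real.
move=> M cM u /= u1; apply: le_trans (ltW cM).
have := cle u; rewrite u1 -ler_pdivlMl// mulr1 => uc.
have [u1'|] := leP `|u| 1; first by rewrite (le_trans u1')// lerDr invr_ge0 ltW.
move=> u1'; apply: le_trans (_ : c^-1 <= _); last by rewrite lerDl.
by apply: le_trans uc; rewrite expr2 ler_peMl// ltW.
Qed.

Lemma mirror_dirs_opp K u : mirror_dirs K u -> mirror_dirs K (- u).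
Proof.
move=> [u1 Ku]; split; first by rewrite !bil_linE opprK.
by move=> x /Ku; rewrite !bil_linE scalerN mulrN scaleNr opprK.
Qed.

(** The reflection in the image of [v] under the reflection in [u] is the
    conjugate of the reflection in [v] by that in [u]. *)
Lemma mirror_dirs_reflect K u v : mirror_dirs K u -> mirror_dirs K v ->
  mirror_dirs K ((2 * bil B u v) *: u - v).
Proof.
move=> [u1 Ku] [v1 Kv]; have vu := bilC u v sB.
split; first by rewrite !bil_linE (bilC v u sB) u1 v1; ring.
move=> x Kx; have := Ku _ (Kv _ (Ku _ Kx)).
rewrite !bil_linE u1 (bilC v u sB).
set a := bil B x u; set b := bil B x v; set d := bil B u v.
by congr K; apply/rowP => i; rewrite !mxE; ring.
Qed.

Definition orthonormal_pair u v :=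
  [/\ bil B u u = 1, bil B v v = 1 & bil B u v = 0].

(** Reflecting the direction at angle [(k - 1) t] in the one at angle [k t]
    gives, up to sign, the one at angle [(k + 1) t]. *)
Lemma mirror_dirs_multiples K u v t : orthonormal_pair u v ->
  mirror_dirs K u -> mirror_dirs K (cos t *: u + sin t *: v) ->
  forall k, mirror_dirs K (cos (k%:R * t) *: u + sin (k%:R * t) *: v).
Proof.
move=> [u1 v1 uv] Ku Kt k.
suff : mirror_dirs K (cos (k%:R * t) *: u + sin (k%:R * t) *: v) /\
       mirror_dirs K (cos (k.+1%:R * t) *: u + sin (k.+1%:R * t) *: v) by case.
elim: k => [|k [Kk Kk1]].
  by rewrite mul0r mul1r cos0 sin0 scale1r scale0r addr0.
split => //; have := mirror_dirs_reflect Kk1 Kk.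
pose a := k.+1%:R * t.
have -> : k%:R * t = a - t by rewrite /a -natr1; ring.
have -> : k.+2%:R * t = a + t by rewrite /a -[k.+2%:R]natr1; ring.
rewrite -/a cosB sinB cosD sinD.
have a1 := cos2Dsin2 a; have t1 := cos2Dsin2 t.
set ca := cos a in a1 *; set sa := sin a in a1 *.
set ct := cos t in t1 *; set st := sin t in t1 *.
have -> : bil B (ca *: u + sa *: v)
    ((ca * ct + sa * st) *: u + (sa * ct - ca * st) *: v) = ct.
  rewrite !bil_linE (bilC v u sB) u1 v1 uv.
  by rewrite -[RHS]mulr1 -[X in _ = _ * X]a1; ring.
by congr (mirror_dirs K _); apply/rowP => i; rewrite !mxE; ring.
Qed.

(** A limit of mirror directions at smaller and smaller angles yields a whole
    circle of mirror directions.  The compact set [T] of pairs records in which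
    planes these directions, hence the limiting circle, lie. *)
Lemma mirror_circle K (T : set ('rV[R]_n * 'rV[R]_n)) : closed K -> compact T ->
  (forall q, T q -> orthonormal_pair q.1 q.2) ->
  (forall c, c < 1 -> exists q t, [/\ T q, 0 < t <= pi, c < cos t &
     mirror_dirs K q.1 /\ mirror_dirs K (cos t *: q.1 + sin t *: q.2)]) ->
  exists2 q, T q & forall a b, a ^+ 2 + b ^+ 2 = 1 ->
    mirror_dirs K (a *: q.1 + b *: q.2).
Proof.
move=> cK cT Tortho small.
have /choice[s sP] : forall k : nat, exists qt : ('rV[R]_n * 'rV[R]_n) * R,
    [/\ T qt.1, 0 < qt.2 <= pi, 1 - k.+1%:R^-1 < cos qt.2 &
     mirror_dirs K qt.1.1 /\
     mirror_dirs K (cos qt.2 *: qt.1.1 + sin qt.2 *: qt.1.2)].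
  move=> k; have [|q [t H]] := small (1 - k.+1%:R^-1); last by exists (q, t).
  by rewrite ltrBlDr ltrDl invr_gt0.
have [|q Tq clq] := compact_seq_cluster (u := fun k => (s k).1) cT.
  by move=> k; case: (sP k).
exists q => //.
suff upper a b : 0 <= b -> a ^+ 2 + b ^+ 2 = 1 -> mirror_dirs K (a *: q.1 + b *: q.2).
  move=> a b ab; have [b0|b0] := leP 0 b; first exact: upper.
  have -> : a *: q.1 + b *: q.2 = - ((- a) *: q.1 + (- b) *: q.2).
    by rewrite !scaleNr opprD !opprK.
  apply: mirror_dirs_opp.
  by apply: upper; rewrite ?sqrrN// oppr_ge0 ltW.
move=> b0 ab.
have a1 : -1 <= a <= 1.
  rewrite -ler_norml -(@ler_sqr _ `|a|) ?nnegrE// real_normK ?num_real//.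
  by rewrite expr1n -ab lerDl sqr_ge0.
pose phi := acos a.
have phi0 : 0 <= phi by exact: acos_ge0.
have aE : a = cos phi by rewrite acosK// in_itv.
have bE : b = sin phi.
  by rewrite sin_acos// -ab addrC addKr sqrtr_sqr ger0_norm.
rewrite aE bE; set p := _ + _.
have [c c0 cle] := posdef_norm.
apply: contrapT => np.
have [e /= e0 ballp] : exists2 e : R, 0 < e & forall y, `|p - y| < e -> ~ mirror_dirs K y.
  have : nbhs p (~` mirror_dirs K).
    by apply: open_nbhs_nbhs; split => //; rewrite openC; exact: closed_mirror_dirs.
  by move=> /nbhs_ballP[e e0 H]; exists e => // y py; apply: H; rewrite -ball_normE.
pose F (z : 'rV[R]_n * 'rV[R]_n) := cos phi *: z.1 + sin phi *: z.2.
have cF : continuous F by rewrite /F; cont.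
have nF : nbhs q [set z | `|F q - F z| < e / 2].
  have /cvgrPdist_lt := cF q; apply; exact: divr_gt0.
have [N HN] : exists N : nat, forall k, (N <= k)%N -> 2 * k.+1%:R^-1 < c * (e / 2) ^+ 2.
  have d0 : 0 < c * (e / 2) ^+ 2 / 2 by rewrite divr_gt0// mulr_gt0// exprn_gt0// divr_gt0.
  have [N _ H] := near_infty_natSinv_lt (PosNum d0).
  by exists N => k /H /=; rewrite ltr_pdivlMr// mulrC.
have [k Nk /= kF] := clq _ nF N.
have [Tk /andP[t0 tpi] ct [K0 K1]] := sP k.
have [u1 v1 uv] := Tortho _ Tk.
set t := (s k).2 in t0 tpi ct K0 K1 *; set u := (s k).1.1 in K0 K1 u1 uv *.
set v := (s k).1.2 in K1 v1 uv *.
pose j := Num.truncn (phi / t).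
have [j0 j1] : j%:R * t <= phi /\ phi < j.+1%:R * t.
  have /truncn_itv/andP[H1 H2] : 0 <= phi / t by rewrite divr_ge0// ltW.
  by rewrite -ler_pdivlMr// -ltr_pdivrMr.
pose d := phi - j%:R * t.
have d0 : 0 <= d by rewrite subr_ge0.
have dt : d < t by rewrite /d ltrBlDl; move: j1; rewrite -natr1 mulrDl mul1r.
have cd : cos t < cos d.
  by rewrite ltr_cos// in_itv/= ?d0 ?(ltW t0)// (le_trans (ltW dt)).
apply: (ballp (cos (j%:R * t) *: u + sin (j%:R * t) *: v)); last first.
  exact: (mirror_dirs_multiples (And3 u1 v1 uv)).
rewrite -[p](subrK (F (s k).1)) -addrA; apply: le_lt_trans (ler_normD _ _) _.
rewrite [e]splitr; apply: ltrD => //.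
rewrite -(@ltr_sqr _ `|_|) ?nnegrE ?divr_ge0 ?(ltW e0)//.
rewrite -(ltr_pM2l c0); apply: le_lt_trans (cle _) _.
apply: le_lt_trans (HN _ Nk).
pose al := j%:R * t.
have phiE : phi = al + d by rewrite /d addrC subrK.
rewrite -/al; clearbody al d.
have -> : bil B (F (s k).1 - (cos al *: u + sin al *: v))
                (F (s k).1 - (cos al *: u + sin al *: v)) = 2 - 2 * cos d.
  rewrite /F -/u -/v phiE cosD sinD.
  have a2 := cos2Dsin2 al; have d2 := cos2Dsin2 d.
  rewrite !bil_linE (bilC v u sB) u1 v1 uv.
  set ca := cos al in a2 *; set sa := sin al in a2 *.
  set cd' := cos d in d2 *; set sd := sin d in d2 *.
  transitivity ((ca ^+ 2 + sa ^+ 2) * (cd' ^+ 2 + sd ^+ 2) +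
                (ca ^+ 2 + sa ^+ 2) * (1 - 2 * cd')).
    ring.
  by rewrite a2 d2; ring.
by move: ct cd; set w := k.+1%:R^-1; lra.
Qed.

End Mirrors.

(** * Round sections *)

Section Round.
Variables (R : realType) (n : nat) (B : 'M[R]_n).
Hypothesis pB : posdef B.
Implicit Types (u v w x y c : 'rV[R]_n) (K : set 'rV[R]_n).

Let sB := pB.1.

(** The reflection in the difference of two vectors of the same length
    exchanges them. *)
Lemma mirror_exchange K (P : set 'rV[R]_n) c x y :
  (forall a z z', P z -> P z' -> P (a *: z + z')) ->
  (forall u, P u -> bil B u u = 1 -> mirror_dirs B K u) ->
  (forall u, P u -> bil B c u = 0) ->
  P (x - c) -> P (y - c) ->
  bil B (x - c) (x - c) = bil B (y - c) (y - c) -> K y -> K x.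
Proof.
move=> linP PK cP Px Py xy Ky; have [->//|nxy] := eqVneq x y.
have d0 : y - x != 0 by rewrite subr_eq0 eq_sym.
have dP : P (y - x).
  have := linP (-1) _ _ Px Py; rewrite scaleN1r opprB addrC -addrA.
  by rewrite [- c + _]addrA addNr add0r.
have bd := pB.2 _ d0.
pose s := (Num.sqrt (bil B (y - x) (y - x)))^-1.
have ss : s * s * bil B (y - x) (y - x) = 1.
  by rewrite -invfM -expr2 sqr_sqrtr ?ltW// mulVf ?gt_eqF.
have P0 : P 0 by have := linP (-1) _ _ dP dP; rewrite scaleN1r addNr.
have [_ /(_ _ Ky)] : mirror_dirs B K (s *: (y - x)).
  apply: PK; last by rewrite bilZl bilZr mulrA.
  by rewrite -[_ *: _]addr0; exact: linP.
congr K; have : 2 * bil B y (y - x) = bil B (y - x) (y - x).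
  have := cP _ dP; move: xy.
  rewrite !bil_linE (bilC y x sB) (bilC x c sB) (bilC y c sB) => H1 H2.
  by apply/eqP; rewrite -subr_eq0; apply/eqP; lra.
rewrite bilZr scalerA => H.
rewrite (_ : 2 * _ * s = 1) ?scale1r ?subKr//.
by rewrite -[RHS]ss -H; ring.
Qed.

(** The reflections in directions of [P] act transitively on the spheres centred
    at [c] in the affine subspace [c + P].  So [K] contains the sphere through a
    farthest point of its section, and the ball it bounds by convexity. *)
Lemma round_section K (P : set 'rV[R]_n) c : compact K -> convex_set K ->
  closed P ->
  (forall a z z', P z -> P z' -> P (a *: z + z')) ->
  (forall u, P u -> bil B u u = 1 -> mirror_dirs B K u) ->
  (forall u, P u -> bil B c u = 0) ->
  (forall x, K x -> ~ P (x - c)) \/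
  exists2 e, 0 <= e &
    forall x, P (x - c) -> (K x <-> bil B (x - c) (x - c) <= e ^+ 2).
Proof.
move=> cK convK cP linP PK bP.
pose X := K `&` [set x | P (x - c)].
have [X0|nX] := pselect (X !=set0); last first.
  by left => x Kx Px; apply: nX; exists x.
right; have cX : compact X.
  apply: compact_closedI => //.
  by apply: (@closed_preimage _ _ (fun x => x - c) P) => //; cont.
have [|y /set_mem[Ky Py] ymax] :=
    @compact_EVT_max _ R (fun x => bil B (x - c) (x - c)) X X0 cX.
  by apply: continuous_subspaceT; rewrite /bil; cont.
exists (Num.sqrt (bil B (y - c) (y - c))); first exact: sqrtr_ge0.
rewrite sqr_sqrtr ?bil_ge0// => x Px; split => [Kx|].
  by apply: ymax; apply/mem_set.
have P0 : P 0 by have := linP (-1) _ _ Py Py; rewrite scaleN1r addNr.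
set m := bil B (y - c) (y - c) => xm.
(* The point [x] lies on a diameter whose endpoints are as far from the
   centre as [y]. *)
have [w [s [Pw wm s01 xE]]] : exists w s,
    [/\ P w, bil B w w = m, 0 <= s <= 1 & x - c = s *: w].
  have [x0|x0] := eqVneq (x - c) 0.
    by exists (y - c), 0; rewrite x0 scale0r lexx ler01.
  have bx := pB.2 _ x0.
  pose s := Num.sqrt (bil B (x - c) (x - c) / m).
  have m0 : 0 < m by exact: lt_le_trans xm.
  have q0 := ltW (divr_gt0 bx m0).
  have s0 : 0 < s by rewrite sqrtr_gt0 divr_gt0.
  exists (s^-1 *: (x - c)), s; split.
  - by rewrite -[_ *: _]addr0; exact: linP.
  - rewrite bilZl bilZr mulrA -invfM -expr2 sqr_sqrtr//.
    by rewrite invf_div divfK// gt_eqF.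
  - rewrite (ltW s0) /= -(@ler_sqr _ s) ?nnegrE ?(ltW s0)//.
    by rewrite expr1n sqr_sqrtr// ler_pdivrMr ?mul1r.
  - by rewrite scalerA divff ?scale1r// gt_eqF.
have Kw a : a ^+ 2 = 1 -> K (c + a *: w).
  move=> a1; apply: (mirror_exchange linP PK bP _ Py) Ky.
    by rewrite addrAC subrr add0r -[_ *: _]addr0; exact: linP.
  by rewrite addrAC subrr add0r bilZl bilZr mulrA -expr2 a1 mul1r.
have -> : x = ((1 + s) / 2) *: (c + 1 *: w) + (1 - (1 + s) / 2) *: (c + (-1) *: w).
  by rewrite -[LHS](subrK c) xE; apply/rowP => i; rewrite !mxE; field.
move/andP: s01 => [s0 s1]; apply: (convex_setP convK).
- by apply: Kw; rewrite expr1n.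
- by apply: Kw; rewrite sqrrN expr1n.
- by apply/andP; split; lra.
Qed.

End Round.

Section Cholesky.
Variable R : realType.

(** Cholesky factorisation, by induction through the Schur complement of the
    upper left entry. *)
Lemma posdef_factor n (B : 'M[R]_n) : posdef B -> exists2 M, M \in unitmx & B = M *m M^T.
Proof.
move=> pB; suff [M BM] : exists M : 'M[R]_n, B = M *m M^T.
  exists M => //; rewrite -row_free_unit -kermx_eq0; apply/rowV0P => u.
  move=> /sub_kermxP uM; apply: (bil_eq0 pB).
  by rewrite BM /bil mulmxA uM mul0mx dot0l.
elim: n B pB => [|n IH] B pB; first by exists 0; apply/matrixP => -[].
rewrite -[n.+1]/(1 + n)%N in B pB *.
have [sB _] := pB.
pose a := ulsubmx B 0 0; pose b := ursubmx B; pose C := drsubmx B.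
have BE : B = block_mx a%:M b b^T C.
  rewrite -[LHS]submxK [ulsubmx B]mx11_scalar; congr block_mx.
  by rewrite -{1}sB -trmx_ursub.
have a0 : 0 < a.
  have -> : a = B (lshift n 0) (lshift n 0) by rewrite /a !mxE.
  rewrite -bil_delta; apply: pB.2; apply/eqP => /matrixP/(_ 0 (lshift n 0)).
  by rewrite !mxE !eqxx => /eqP; rewrite oner_eq0.
pose S := C - a^-1 *: (b^T *m b).
have CT : C^T = C by rewrite /C trmx_drsub sB.
have [|N SN] := IH S.
  split; first by rewrite linearB/= linearZ/= trmx_mul trmxK CT.
  move=> y y0; pose u := - (a^-1 *: (y *m b^T)).
  have -> : bil S y y = bil B (row_mx u y) (row_mx u y).
    rewrite /bil BE mul_row_block mul_mx_scalar.
    have -> : a *: u + y *m b^T = 0.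
      by rewrite scalerN scalerA divff ?gt_eqF// scale1r addNr.
    have -> : u *m b + y *m C = y *m S.
      by rewrite mulNmx -scalemxAl mulmxBr -scalemxAr mulmxA addrC.
    by rewrite !dotE tr_row_mx mul_row_col mul0mx add0r.
  apply: pB.2; apply: contraNneq y0 => /(congr1 rsubmx).
  by rewrite row_mxKr linear0 => ->.
pose r := Num.sqrt a.
have r0 : r != 0 by rewrite sqrtr_eq0 -ltNge.
have rr : r * r = a by rewrite -expr2 sqr_sqrtr ?ltW.
exists (block_mx r%:M 0 (r^-1 *: b^T) N).
rewrite BE tr_block_mx mulmx_block tr_scalar_mx trmx0 linearZ/= trmxK.
rewrite !mulmx0 !mul0mx !addr0 -SN -scalar_mxM rr.
congr block_mx.
- by rewrite mul_scalar_mx scalerA divff// scale1r.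
- by rewrite mul_mx_scalar scalerA divff// scale1r.
by rewrite -scalemxAl -scalemxAr scalerA -invfM rr /S addrC subrK.
Qed.

End Cholesky.

(** * Ellipsoids and rotational bodies *)

Section Conclusions.
Variables (R : realType) (n : nat) (B : 'M[R]_n).
Hypothesis pB : posdef B.
Implicit Types (u v w x y c : 'rV[R]_n) (K : set 'rV[R]_n).

Let sB := pB.1.

Lemma compact_translate K x0 : compact K -> compact [set x | K (x0 + x)].
Proof.
move=> cK; rewrite (_ : [set _ | _] = (fun x => x - x0) @` K).
  by apply: continuous_compact => //; apply: continuous_subspaceT; cont.
apply/seteqP; split => [x /= Kx|_ [x Kx <-]] /=; last by rewrite addrC subrK.
by exists (x0 + x) => //; rewrite addrC addKr.
Qed.

Lemma convex_translate K x0 : convex_set K -> convex_set [set x | K (x0 + x)].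
Proof.
move=> cK x y t; rewrite !inE /= => Kx Ky.
have := cK (x0 + x) (x0 + y) t (mem_set Kx) (mem_set Ky); rewrite inE.
congr K; rewrite /conv /= !scalerDr addrACA -scalerDl.
by rewrite subrKC scale1r.
Qed.

(** A factorisation [B = M *m M^T] makes [x |-> x *m M] an isometry from the form
    [B] to the Euclidean one, so [B]-balls are ellipsoids. *)
Lemma ellipsoid_of_mirrors K x0 : (0 < n)%N -> convex_body K ->
  (forall u, bil B u u = 1 -> mirror_dirs B [set x | K (x0 + x)] u) ->
  ellipsoid K.
Proof.
move=> n0 [cK convK [k0 k0int]] allK.
have Kk0 : K k0 by exact: interior_subset.
have [H|[e e0 Ke]] := @round_section R n B pB [set x | K (x0 + x)] setT 0
    (@compact_translate K x0 cK) (@convex_translate K x0 convK) closedT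
    (fun _ _ _ _ _ => I) (fun u _ => allK u) (fun u _ => bil0l B u).
  by exfalso; apply: (H (k0 - x0)) => //=; rewrite addrC subrK.
have {}Ke x : K x <-> bil B (x - x0) (x - x0) <= e ^+ 2.
  by have := Ke (x - x0) I; rewrite subr0 /= [x0 + _]addrC subrK.
have e1 : 0 < e.
  rewrite lt_def e0 andbT; apply/eqP => eE.
  have K1 x : K x -> x = x0.
    move/Ke; rewrite eE expr0n => x0le.
    by apply/eqP; rewrite -subr_eq0; apply/eqP/(bil_eq0 pB)/eqP;
      rewrite eq_le x0le bil_ge0.
  have /nbhs_ballP[r /= r0 rK] := k0int.
  pose d : 'rV[R]_n := const_mx (r / 2).
  have : K (k0 + d).
    apply: rK; rewrite -ball_normE /= opprD addNKr normrN.
    apply: le_lt_trans (_ : r / 2 < _); last by rewrite ltr_pdivrMr// mulr_natr mulr2n ltrDl.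
    apply: norm_le_coord => [|i j]; first by rewrite divr_ge0// ltW.
    by rewrite mxE gtr0_norm// divr_gt0.
  move/K1; rewrite (K1 _ Kk0) => /eqP; rewrite -subr_eq0 addrAC subrr add0r.
  move/eqP/rowP/(_ (Ordinal n0)); rewrite !mxE => /eqP.
  by rewrite mulf_eq0 invr_eq0 pnatr_eq0 orbF gt_eqF.
have [M uM BM] := posdef_factor pB.
have bM x : bil B x x = dot (x *m M) (x *m M).
  have BM1 : B = M *m 1%:M *m M^T by rewrite mulmx1.
  by rewrite BM1 bil_congr /bil mulmx1.
exists 0, e, (invmx M), x0; split => //; first by rewrite unitmx_inv.
have dotle x : (Num.sqrt (dot x x) <= e) = (dot x x <= e ^+ 2).
  by rewrite -(@ler_sqr _ (Num.sqrt _)) ?nnegrE ?sqrtr_ge0// sqr_sqrtr ?dot_ge0.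
apply/seteqP; split => [x /Ke|_ [z /= ze <-]].
  rewrite bM => xe; exists ((x - x0) *m M); last by rewrite mulmxK// subrK.
  by rewrite /eball /= subr0 dotle.
move: ze; rewrite /eball /= subr0 dotle => ze.
by apply/Ke; rewrite addrK bM mulmxKV.
Qed.

(** The eigenspaces of [B] are where [bil B] and [dot] are proportional, so a
    circle of mirrors in an eigenspace is a circle of Euclidean mirrors. *)
Lemma rotational_of_circle K x0 e1 e2 : convex_body K ->
  orthonormal_pair B e1 e2 ->
  dot e1 e1 *: (e1 *m B) = e1 -> dot e1 e1 *: (e2 *m B) = e2 ->
  (forall a b, a ^+ 2 + b ^+ 2 = 1 ->
     mirror_dirs B [set x | K (x0 + x)] (a *: e1 + b *: e2)) ->
  S1_rotational K.
Proof.
move=> [cK convK _] [e11 e22 e12] E1 E2 circ.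
have e10 : e1 != 0 by apply/eqP => e0; move/eqP: e11; rewrite e0 bil0l eq_sym oner_eq0.
have e20 : e2 != 0 by apply/eqP => e0; move/eqP: e22; rewrite e0 bil0l eq_sym oner_eq0.
have e21 : bil B e2 e1 = 0 by rewrite bilC.
(* The inverse of the eigenvalue of [B] on the plane of the circle. *)
pose mu := dot e1 e1; have mu0 : 0 < mu by rewrite dot_gt0.
pose pr x := bil B x e1 *: e1 + bil B x e2 *: e2.
pose P := [set x | pr x = x].
have be1 x : mu * bil B x e1 = dot x e1 by rewrite bilC// /bil -dotZl E1 dotC.
have be2 x : mu * bil B x e2 = dot x e2 by rewrite bilC// /bil -dotZl E2 dotC.
have bP x u : P u -> mu * bil B x u = dot x u.
  by move=> <-; rewrite /pr !bil_linE !dot_linE -be1 -be2; ring.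
pose A : 'M[R]_n := B *m (e1^T *m e1 + e2^T *m e2).
have prA x : pr x = x *m A.
  rewrite /A mulmxA mulmxDr !mulmxA [_ *m e1^T]mx11_scalar [_ *m e2^T]mx11_scalar.
  by rewrite -!dotE !mul_scalar_mx.
have linP a z z' : P z -> P z' -> P (a *: z + z').
  by rewrite /P /= !prA => Pz Pz'; rewrite mulmxDl -scalemxAl Pz Pz'.
have Pe1 : P e1 by rewrite /P /= /pr e11 e12 scale1r scale0r addr0.
have Pe2 : P e2 by rewrite /P /= /pr e22 e21 scale1r scale0r add0r.
have prP x : P (pr x).
  have P0 : P 0 by rewrite /P /= prA mul0mx.
  by apply: (linP) => //; rewrite -[_ *: e2]addr0; apply: (linP).
have prE x : bil B (x - pr x) e1 = 0 /\ bil B (x - pr x) e2 = 0.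
  by rewrite /pr !bil_linE e11 e22 e12 e21; split; ring.
pose F : {vspace 'rV[R]_n} := (<[e1]> + <[e2]>)%VS.
have FP x : (x \in F) <-> P x.
  split.
    case/memv_addP => _ /vlineP[a ->] [_ /vlineP[b ->] ->].
    apply: (linP) => //; rewrite -[_ *: e2]addr0; apply: (linP) => //.
    by rewrite /P /= prA mul0mx.
  by move=> <-; rewrite memv_add// memvZ// memv_line.
have dF : \dim F = 2%N.
  have d1 : \dim <[e1]>%VS = 1%N by rewrite dim_vline e10.
  have [le1 eq1] := dimv_leqif_sup (addvSl <[e1]>%VS <[e2]>%VS).
  apply/eqP; rewrite eqn_leq; apply/andP; split.
    by apply: leq_trans (dimv_add_leqif _ _).1 _; rewrite !dim_vline e10 e20.
  suff : (\dim <[e1]>%VS < \dim F)%N by rewrite d1.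
  rewrite ltn_neqAle le1 andbT eq1; apply/negP => /subvP/(_ e2).
  have := memv_add (mem0v <[e1]>%VS) (memv_line e2); rewrite add0r => e2F /(_ e2F).
  case/vlineP => k e2E; move/eqP: e12; rewrite e2E bilZr e11 mulr1 => /eqP k0.
  by move: e20; rewrite e2E k0 scale0r eqxx.
pose f : 'End('rV[R]_n) := linfun (mulmxr A).
have fE x : f x = pr x by rewrite lfunE /= prA.
pose V := lker f.
have VE x : x \in V <-> dot x e1 = 0 /\ dot x e2 = 0.
  rewrite memv_ker fE; split => [/eqP prx|[x1 x2]].
    have [] := prE x; rewrite prx subr0 => H1 H2.
    by rewrite -be1 -be2 H1 H2 mulr0.
  have /eqP := be1 x; rewrite x1 mulf_eq0 (gt_eqF mu0) => /eqP b1.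
  have /eqP := be2 x; rewrite x2 mulf_eq0 (gt_eqF mu0) => /eqP b2.
  by rewrite /pr b1 b2 !scale0r addr0.
have VP x u : x \in V -> P u -> dot x u = 0.
  by move=> /VE[x1 x2] <-; rewrite /pr !dot_linE x1 x2 !mulr0 addr0.
have limgF : limg f = F.
  apply/eqP; rewrite eqEsubv; apply/andP; split; apply/subvP => x.
    by case/memv_imgP => y _ ->; rewrite fE; apply/FP.
  by move/FP => Px; apply/memv_imgP; exists x; rewrite ?memvf// fE Px.
exists x0, V; split.
  have := limg_ker_dim f fullv; rewrite capfv limgF dF dimvf /dim /= mul1n => H.
  by rewrite -addn2.
move=> p W dW VW.
have WF : W = F.
  apply/eqP; rewrite eqEdim dW dF leqnn andbT; apply/subvP => w Ww.
  apply/FP; apply/eqP; rewrite eq_sym -subr_eq0 -dot_eq0.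
  have w'V : w - pr w \in V.
    by apply/VE; have [H1 H2] := prE w; rewrite -be1 -be2 H1 H2 mulr0.
  by rewrite dotDr (VW _ _ w'V Ww) dotNr (VP _ _ w'V (prP _)) subrr.
pose c0 := (p - x0) - pr (p - x0).
have c0V : c0 \in V.
  by apply/VE; have [H1 H2] := prE (p - x0); rewrite -be1 -be2 H1 H2 mulr0.
pose c := x0 + c0.
have flatE x : flat p W x <-> P (x - x0 - c0).
  rewrite /flat /= WF; have -> : x - p = (x - x0 - c0) + (- 1) *: pr (p - x0).
    by rewrite /c0 scaleN1r; apply/rowP => i; rewrite !mxE; ring.
  split => [/FP H|H]; last by apply/FP; rewrite addrC; apply: (linP).
  have := linP 1 _ _ (prP (p - x0)) H.
  by rewrite scale1r scaleN1r addrC subrK.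
have c0P u : P u -> bil B c0 u = 0.
  move=> Pu; have /eqP := bP c0 u Pu; rewrite (VP _ _ c0V Pu) mulf_eq0 (gt_eqF mu0).
  by move/eqP.
have unitP u : P u -> bil B u u = 1 -> mirror_dirs B [set x | K (x0 + x)] u.
  move=> Pu u1; rewrite -[u]Pu; apply: circ; rewrite -u1.
  by rewrite -[in RHS]Pu /pr !bil_linE e11 e22 e12 e21; ring.
have cP : closed P by apply: closed_eqf; rewrite /pr /bil; cont.
have KE x : [set y | K (x0 + y)] (x - x0) <-> K x by rewrite /= addrC subrK.
have [H|[e e0 Ke]] := round_section pB (@compact_translate K x0 cK)
    (@convex_translate K x0 convK) cP linP unitP c0P.
  constructor 1; apply/seteqP; split => // x [/flatE Px /KE Kx].
  by have := H _ Kx.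
have {}Ke x : flat p W x -> (K x <-> dot (x - c) (x - c) <= mu * e ^+ 2).
  move=> /flatE Px; have -> : x - c = x - x0 - c0 by rewrite /c opprD addrA.
  rewrite -KE (Ke _ Px) -(bP _ _ Px).
  by rewrite ler_pM2l.
have cflat : flat p W c.
  by apply/flatE; rewrite /c -addrA -opprD subrr /P /= prA mul0mx.
move: e0; rewrite le_eqVlt => /predU1P[e0|e0].
  constructor 2; exists c; apply/seteqP; split => [x [Px /(Ke _ Px)]|_ ->] /=.
    rewrite -e0 expr0n mulr0 => dxc; apply/eqP; rewrite -subr_eq0 -dot_eq0.
    by rewrite eq_le dxc dot_ge0.
  by split => //; apply/(Ke _ cflat); rewrite subrr dot0l mulr_ge0 ?sqr_ge0 ?ltW.
constructor 3; exists c, (Num.sqrt mu * e); split.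
- by rewrite mulr_gt0// sqrtr_gt0.
- apply/seteqP; split => [x [/= xV /flatE Px]|_ ->] /=.
    have xcV : x - c \in V by rewrite /c opprD addrA rpredB.
    apply/eqP; rewrite -subr_eq0 -dot_eq0; apply/eqP; apply: VP => //.
    by rewrite /c opprD addrA.
  by split => //; rewrite /flat /= /c addrAC subrr add0r.
have se : (Num.sqrt mu * e) ^+ 2 = mu * e ^+ 2.
  by rewrite exprMn sqr_sqrtr// ltW.
have dotle x : (Num.sqrt (dot x x) <= Num.sqrt mu * e) = (dot x x <= mu * e ^+ 2).
  rewrite -(@ler_sqr _ (Num.sqrt (dot x x))) ?nnegrE ?sqrtr_ge0 ?mulr_ge0
    ?sqrtr_ge0 ?(ltW e0)//.
  by rewrite sqr_sqrtr ?dot_ge0// se.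
apply/seteqP; split => x [Px /=].
  by move/(Ke _ Px) => Kx; split => //; rewrite /eball /= dotle.
by rewrite /eball /= dotle => /(Ke _ Px).
Qed.

End Conclusions.

(** * Eigenvectors of the compressions *)

Section Compressions.
Variables (R : realType) (n : nat) (B : 'M[R]_n).
Hypothesis pB : posdef B.
Implicit Types (u v w x y g l : 'rV[R]_n) (K : set 'rV[R]_n).

Let sB := pB.1.

Lemma open_avoid (V : set 'rV[R]_n) (L : seq 'rV[R]_n) :
  open V -> V !=set0 -> (forall l, l \in L -> l != 0) ->
  exists W, [/\ open W, W !=set0, W `<=` V &
    forall g l, W g -> l \in L -> dot g l != 0].
Proof.
move=> oV V0; elim: L => [_|l L IH L0]; first by exists V; split.
have [|W [oW [g Wg] WV WL]] := IH; first by move=> k kL; apply: L0; rewrite in_cons kL orbT.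
have l0 : l != 0 by apply: L0; rewrite mem_head.
have oH : open [set g | dot g l != 0].
  rewrite -closedC (_ : ~` _ = [set g | dot g l = 0]).
    by apply: closed_eqf; cont.
  by apply/seteqP; split => x /=; [move/negP; rewrite negbK => /eqP|move=> ->; rewrite eqxx].
exists (W `&` [set g | dot g l != 0]); split.
- exact: openI.
- have [gl|gl] := eqVneq (dot g l) 0; last by exists g.
  have /nbhs_ballP[e /= e0 eW] : nbhs g W by apply: open_nbhs_nbhs.
  have nl : 0 < `|l| by rewrite normr_gt0.
  exists (g + (e / 2 / `|l|) *: l); split => /=.
    apply: eW; rewrite -ball_normE /= opprD addNKr normrN normrZ gtr0_norm.
      by rewrite divfK ?gt_eqF// ltr_pdivrMr// mulr_natr mulr2n ltrDl.
    by rewrite !divr_gt0.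
  by rewrite dotDl dotZl gl add0r mulf_neq0 ?dot_eq0// gt_eqF// !divr_gt0.
- by move=> x [/WV].
- move=> x k [Wx xl]; rewrite in_cons => /predU1P[->//|kL].
  exact: WL.
Qed.

(** Gram-Schmidt orthonormalisation, the degenerate cases being set apart. *)
Lemma unit_pair u v : bil B u u = 1 -> bil B v v = 1 ->
  [\/ v = u, v = - u | exists w s, [/\ orthonormal_pair B u w, 0 < s,
     bil B u v ^+ 2 + s ^+ 2 = 1, w = s^-1 *: (v - bil B u v *: u) &
     v = bil B u v *: u + s *: w]].
Proof.
move=> u1 v1; set b := bil B u v; pose z := v - b *: u.
have vu : bil B v u = b by rewrite bilC.
have bz : bil B z z = 1 - b ^+ 2.
  by rewrite /z !bil_linE u1 v1 vu -/b; ring.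
have zE : z = v - b *: u by [].
clearbody z.
have [z0|z0] := eqVneq z 0.
  have : 1 - b ^+ 2 == 0 by rewrite -bz z0 bil0l.
  rewrite subr_eq0 eq_sym sqrf_eq1 => b1.
  have vE : v = b *: u by apply/eqP; rewrite -subr_eq0 -zE; apply/eqP.
  case/orP: b1 => /eqP bE; [constructor 1|constructor 2]; rewrite vE bE.
    by rewrite scale1r.
  by rewrite scaleN1r.
have bz0 := pB.2 _ z0.
pose s := Num.sqrt (bil B z z).
have s0 : 0 < s by rewrite sqrtr_gt0.
have ss : s ^+ 2 = bil B z z by rewrite sqr_sqrtr// ltW.
constructor 3; exists (s^-1 *: z), s; split => //.
- split => //; first by rewrite !bil_linE -ss mulrA -invfM -expr2 mulVf// expf_neq0// gt_eqF.
  by rewrite bilZr zE !bil_linE u1 -/b mulr1 subrr mulr0.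
- by rewrite ss bz addrC subrK.
- by rewrite zE.
- by rewrite scalerA divff ?gt_eqF// scale1r zE addrC subrK.
Qed.

(** Unit eigenvectors; the eigenvalue is the inverse of [dot u u]. *)
Definition eigen_sphere : set 'rV[R]_n :=
  [set u | bil B u u = 1 /\ dot u u *: (u *m B) = u].

Lemma eigen_sphere_same u v : eigen_sphere u -> eigen_sphere v ->
  bil B u v != 0 -> dot u u = dot v v.
Proof.
move=> [u1 uE] [v1 vE] uv.
have H1 : dot u u * bil B u v = dot u v by rewrite /bil -dotZl uE.
have H2 : dot v v * bil B u v = dot u v by rewrite (bilC _ _ sB) /bil -dotZl vE dotC.
by apply: (mulIf uv); rewrite H1 H2.
Qed.

Lemma compact_eigen_sphere : compact eigen_sphere.
Proof.
apply: compact_closedI; first exact: compact_bil_sphere.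
by apply: closed_eqf; cont.
Qed.

(** When eigenvectors among the mirror directions accumulate, close ones share
    their eigenvalue, and the limiting circle stays in an eigenspace. *)
Lemma eigen_circle K : closed K ->
  (forall c, c < 1 -> exists u v, [/\ mirror_dirs B K u /\ eigen_sphere u,
     mirror_dirs B K v /\ eigen_sphere v & c < bil B u v < 1]) ->
  exists e1 e2, [/\ orthonormal_pair B e1 e2, dot e1 e1 *: (e1 *m B) = e1,
    dot e1 e1 *: (e2 *m B) = e2 &
    forall a b, a ^+ 2 + b ^+ 2 = 1 -> mirror_dirs B K (a *: e1 + b *: e2)].
Proof.
move=> cK close.
pose T := [set q : 'rV[R]_n * 'rV[R]_n | orthonormal_pair B q.1 q.2 /\
  (dot q.1 q.1 *: (q.1 *m B) = q.1 /\ dot q.1 q.1 *: (q.2 *m B) = q.2)].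
have cT : compact T.
  rewrite (_ : T = ([set u | bil B u u = 1] `*` [set u | bil B u u = 1]) `&`
    ([set q | bil B q.1 q.2 = 0] `&` ([set q | dot q.1 q.1 *: (q.1 *m B) = q.1]
      `&` [set q | dot q.1 q.1 *: (q.2 *m B) = q.2]))); last first.
    by apply/seteqP; split => q /=; [case=> -[? ? ?] []|case=> -[? ?] [? []]].
  apply: compact_closedI; first by apply: compact_setX; exact: compact_bil_sphere.
  apply: closedI; first by apply: closed_eqf; rewrite /bil; cont.
  by apply: closedI; apply: closed_eqf; cont.
have [|q [? [? ?]] circ] := @mirror_circle R n B pB K T cK cT (fun q Tq => Tq.1);
  last by exists q.1, q.2.
move=> c c1; have [|u [v [[Ku eu] [Kv ev] /andP[cb b1]]]] := close (Num.max c 0).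
  by rewrite gt_max c1 ltr01.
move: cb; rewrite gt_max => /andP[cb b0].
have [u1 uE] := eu; have [v1 vE] := ev.
have uv : dot u u = dot v v by apply: eigen_sphere_same => //; rewrite gt_eqF.
case: (unit_pair u1 v1) => [vu|vu|[w [s [uw s0 bs wE vw]]]].
- by move: b1; rewrite vu u1 ltxx.
- by move: b0; rewrite vu bilNr u1 ltr0N1.
have bint : -1 <= bil B u v <= 1 by apply/andP; split; lra.
have ct : cos (acos (bil B u v)) = bil B u v by rewrite acosK// in_itv.
have st : sin (acos (bil B u v)) = s.
  by rewrite sin_acos// -bs addrC addKr sqrtr_sqr gtr0_norm.
exists (u, w), (acos (bil B u v)); split => /=.
- split => //; split => //=; rewrite wE -scalemxAl mulmxBl -scalemxAl.
  rewrite scalerA mulrC -scalerA scalerBr scalerA [_ * bil B u v]mulrC -scalerA uE.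
  by rewrite uv vE.
- by rewrite acos_lepi// andbT acos_gt0// b1 andbT; lra.
- by rewrite ct.
by rewrite ct st -vw.
Qed.

(** Eigenvectors of the compression of [B] with different eigenvalues are
    orthogonal.  If the eigenvalues agree and [u], [v] are not proportional, some
    combination of them is an eigenvector of [B].  Pairing [u *m B] with vectors of
    its eigenspace then shows that [g] is orthogonal to this whole eigenspace,
    hence to the element of [L] that it contains. *)
Lemma compressed_eigen_unique (L : seq 'rV[R]_n) g u v :
  (forall l, l \in L -> eigen_sphere l) ->
  (forall x, eigen_sphere x -> exists2 l, l \in L & 0 < bil B l x) ->
  (forall l, l \in L -> dot g l != 0) -> g != 0 ->
  bil B u u = 1 -> bil B v v = 1 ->
  compressed_eigen B g u -> compressed_eigen B g v ->
  bil B u g != 0 -> dot u v != 0 -> v = u \/ v = - u.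
Proof.
move=> LE EL gL g0 u1 v1 [ug uE] [vg vE] bug uv.
have gg : dot g g != 0 by rewrite dot_eq0.
have uu : dot u u != 0.
  by rewrite dot_eq0; apply: contraNneq bug => ->; rewrite bil0l.
have vv : dot v v != 0 by rewrite dot_eq0; apply: contraNneq uv => ->; rewrite dot0r.
pose k x := dot x x * bil B x g / dot g g.
have eqn x : bil B x x = 1 -> (dot x x * dot g g) *: (x *m B) =
    (dot g g * bil B x x) *: x + (dot x x * bil B x g) *: g ->
    dot x x *: (x *m B) = x + k x *: g.
  move=> x1 H; apply: (scalerI gg); rewrite scalerA mulrC H x1 mulr1 scalerDr.
  by congr (_ + _); rewrite scalerA; congr (_ *: _); rewrite /k [RHS]mulrC divfK.
have {}uE := eqn _ u1 uE; have {}vE := eqn _ v1 vE.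
have ku : k u != 0 by rewrite /k !mulf_neq0// invr_eq0.
have nu : dot u u = dot v v.
  have H1 : dot u u * bil B u v = dot u v.
    by rewrite /bil -dotZl uE dotDl dotZl (dotC g) vg mulr0 addr0.
  have H2 : dot v v * bil B u v = dot u v.
    by rewrite (bilC _ _ sB) /bil -dotZl vE dotDl dotZl (dotC g) ug mulr0 addr0 dotC.
  have b0 : bil B u v != 0 by apply: contraNneq uv => b0; rewrite -H1 b0 mulr0.
  by apply: (mulIf b0); rewrite H1 H2.
pose w := k v *: u - k u *: v.
have wE : dot u u *: (w *m B) = w.
  transitivity (k v *: (dot u u *: (u *m B)) - k u *: (dot v v *: (v *m B))).
    by rewrite -nu mulmxBl -!scalemxAl scalerBr !scalerA !(mulrC (dot u u)).
  by rewrite uE vE; apply/rowP => i; rewrite !mxE; ring.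
have w0 : w = 0.
  apply: contrapT => /eqP w0; have bw := pB.2 _ w0.
  pose s := (Num.sqrt (bil B w w))^-1.
  have s0 : s != 0 by rewrite invr_eq0 sqrtr_eq0 -ltNge.
  have e1 : bil B (s *: w) (s *: w) = 1.
    by rewrite bilZl bilZr mulrA -invfM -expr2 sqr_sqrtr ?ltW// mulVf ?gt_eqF.
  have ew : eigen_sphere (s *: w).
    split => //; have : dot u u * bil B (s *: w) (s *: w) = dot (s *: w) (s *: w).
      by rewrite /bil -dotZl -scalemxAl scalerA mulrC -scalerA wE.
    rewrite e1 mulr1 => <-.
    by rewrite -scalemxAl scalerA mulrC -scalerA wE.
  have [l lL bl] := EL _ ew.
  have [l1 lE] := LE _ lL.
  have nl : dot l l = dot u u.
    rewrite (eigen_sphere_same (LE _ lL) ew) ?gt_eqF//.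
    have [_ H] := ew; have := congr1 (fun z => dot z (s *: w)) H; rewrite dotZl.
    rewrite -[dot (_ *m B) _]/(bil B _ _) e1 mulr1 => {}H.
    have H' : dot u u * bil B (s *: w) (s *: w) = dot (s *: w) (s *: w).
      by rewrite /bil -dotZl -scalemxAl scalerA mulrC -scalerA wE.
    by rewrite -H' e1 mulr1.
  have := congr1 (dot l) uE; rewrite dotZr dotDr dotZr.
  have -> : dot u u * dot l (u *m B) = dot l u.
    by rewrite dotC -[dot (_ *m B) _]/(bil B u l) (bilC _ _ sB) /bil -dotZl -nl lE.
  move/eqP; rewrite eq_sym -subr_eq0 addrAC subrr add0r mulf_eq0 (negbTE ku) /=.
  by rewrite dotC (negbTE (gL _ lL)).
have vE' : v = (k v / k u) *: u.
  apply: (scalerI ku); rewrite scalerA mulrC divfK//.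
  by apply/eqP; rewrite eq_sym -subr_eq0; apply/eqP.
set c := k v / k u in vE'.
have : c ^+ 2 == 1.
  by move/eqP: v1; rewrite vE' bilZl bilZr u1 mulr1 -expr2.
by rewrite sqrf_eq1 vE' => /orP[] /eqP ->; [left; rewrite scale1r|right; rewrite scaleN1r].
Qed.

End Compressions.

(** * Open sets of ground hyperplanes *)

Section Dichotomy.
Variables (R : realType) (n : nat) (B : 'M[R]_n).
Hypothesis pB : posdef B.
Implicit Types (u v w x y g l : 'rV[R]_n) (K W : set 'rV[R]_n).

Let sB := pB.1.

(** Any circle through an interior point [u1] of the set of mirror directions
    contains mirror directions arbitrarily close to [u1], so it consists of
    them. *)
Lemma all_mirrors_of_open K W u1 : closed K -> open W -> W u1 ->
  bil B u1 u1 = 1 -> (forall u, W u -> bil B u u = 1 -> mirror_dirs B K u) ->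
  forall u, bil B u u = 1 -> mirror_dirs B K u.
Proof.
move=> cK oW Wu1 u11 WK u uu1; have Ku1 := WK _ Wu1 u11.
case: (unit_pair pB u11 uu1) => [->//|->|[w [s [ow s0 bs _ ->]]]].
  exact: mirror_dirs_opp.
have [|c c1|q -> circ] := @mirror_circle R n B pB K [set (u1, w)] cK (@compact_set1 _ _).
- by move=> q ->.
- exists (u1, w); pose p (t : R) := cos t *: u1 + sin t *: w.
  have cp : continuous p.
    have := @continuous_cos R; have := @continuous_sin R => cs cc.
    by apply: continuous_addf; apply: continuous_scalef => //; exact: cst_continuous.
  have p0 : p 0 = u1 by rewrite /p cos0 sin0 scale1r scale0r addr0.
  have n1 : nbhs (0 : R) [set t | W (p t)].
    by apply: cp; rewrite p0; exact: open_nbhs_nbhs.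
  have n2 : nbhs (0 : R) [set t | c < cos t].
    apply: (@continuous_cos R 0 [set z | c < z]); rewrite cos0.
    by apply: open_nbhs_nbhs; split => //; exact: open_gt.
  have n3 : nbhs (0 : R) [set t | t < pi].
    by apply: open_nbhs_nbhs; split; [exact: open_lt|exact: pi_gt0].
  have /nbhs_ballP[r /= r0 rP] : nbhs (0 : R)
      [set t | W (p t) /\ c < cos t /\ t < pi].
    by apply: filterI => //; apply: filterI.
  have [|W2 [c2 p2]] := rP (r / 2).
    rewrite -ball_normE /= sub0r normrN gtr0_norm ?divr_gt0//.
    by rewrite ltr_pdivrMr// mulr_natr mulr2n ltrDl.
  exists (r / 2); split => //=; first by rewrite divr_gt0//= ltW.
  split => //; apply: WK => //.
  have [_ w1 uw] := ow; have r2 := cos2Dsin2 (r / 2).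
  rewrite !bil_linE (bilC w u1 sB) u11 w1 uw.
  by rewrite -[RHS]r2; ring.
by apply: circ.
Qed.

(** By the parallelogram identity: [u] and [v] are long compared to [u - v]. *)
Lemma dot_gt0_near l u v : l != 0 ->
  dot (u - l) (u - l) < dot l l / 8 -> dot (v - l) (v - l) < dot l l / 8 ->
  0 < dot u v.
Proof.
have [a ->] : exists a, u = a + l by exists (u - l); rewrite subrK.
have [b ->] : exists b, v = b + l by exists (v - l); rewrite subrK.
rewrite !addrK -dot_gt0 => ll al bl.
have := dot_ge0 (a + a + l); have := dot_ge0 (b + b + l); have := dot_ge0 (a + b).
rewrite !dot_linE (dotC l a) (dotC l b) (dotC b a); move: al bl.
by lra.
Qed.

(** When the eigenvectors of [B] among the mirror directions do not accumulate,
    every [g] in a smaller open set has a mirror direction that is not an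
    eigenvector of [B].  Near a given direction it is unique up to sign, so that
    following it over an open set of [g] sweeps out an open set of mirror
    directions. *)
Lemma mirrors_everywhere_or_eigen_circle K (V : set 'rV[R]_n) :
  closed K -> open V -> V !=set0 ->
  (forall g, V g -> g != 0 /\ exists2 u, mirror_dirs B K u & compressed_eigen B g u) ->
  (forall c, c < 1 -> exists u v, [/\ mirror_dirs B K u /\ eigen_sphere B u,
     mirror_dirs B K v /\ eigen_sphere B v & c < bil B u v < 1]) \/
  forall u, bil B u u = 1 -> mirror_dirs B K u.
Proof.
move=> cK oV V0 VK; set S := mirror_dirs B K; set E := eigen_sphere B.
have [|/existsNP[c /not_implyP[c1 sep]]] := pselect (forall c, c < 1 -> exists u v,
  [/\ S u /\ E u, S v /\ E v & c < bil B u v < 1]); [by left|right].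
have cE : compact E by exact: compact_eigen_sphere.
have clS : closed S by exact: closed_mirror_dirs.
have cS : compact S.
  rewrite (_ : S = [set u | bil B u u = 1] `&` S).
    by apply: compact_closedI => //; exact: compact_bil_sphere.
  by apply/seteqP; split => [u Su|u []//]; split => //; case: Su.
have cbil l : continuous (bil B l) by rewrite /bil; cont.
have unit0 u : bil B u u = 1 -> u != 0.
  by move=> u1; apply/eqP => u0; move/eqP: u1; rewrite u0 bil0l eq_sym oner_eq0.
(* There are only finitely many eigenvectors among the mirror directions. *)
have [L1 L1E L1cov] := @compact_finite_cover R _ (E `&` S) (fun l => [set x | c < bil B l x])
  (compact_closedI cE clS) (fun l _ => open_ltf (@cst_continuous _ _ c) (cbil l))
  (fun l El => eq_ind_r (fun z => c < z) c1 El.1.1).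
have {}L1cov u : E u -> S u -> u \in L1.
  move=> Eu Su; have [l lL /= cl] := L1cov u (conj Eu Su).
  have [El Sl] := L1E _ lL.
  suff -> : u = l by [].
  apply/eqP; rewrite -subr_eq0; apply/eqP/(bil_eq0 pB)/eqP.
  rewrite eq_le bil_ge0// andbT !bil_linE (bilC l u sB) El.1 Eu.1.
  have : 1 <= bil B u l.
    rewrite leNgt; apply/negP => lt1; apply: sep; exists l, u; split => //.
    by rewrite cl (bilC l u sB).
  by lra.
have [L2 L2E L2cov] := @compact_finite_cover R _ E (fun l => [set x | 0 < bil B l x])
  cE (fun l _ => open_ltf (@cst_continuous _ _ 0) (cbil l))
  (fun l El => eq_ind_r (fun z => 0 < z) ltr01 El.1).
have [|V' [oV' [g0 V'g0] V'V V'L]] := @open_avoid R n V (L1 ++ L2) oV V0.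
  move=> l; rewrite mem_cat => /orP[/L1E[[l1 _] _]|/L2E[l1 _]]; exact: unit0.
have nondeg g u : V' g -> S u -> compressed_eigen B g u -> bil B u g != 0.
  move=> V'g Su [ug uE]; apply/eqP => bug.
  have [gn0 _] := VK _ (V'V _ V'g).
  have gg : dot g g != 0 by rewrite dot_eq0.
  have Eu : E u.
    split; first exact: Su.1.
    apply: (scalerI gg); rewrite scalerA mulrC uE Su.1 bug mulr1 mulr0 scale0r.
    by rewrite addr0.
  have := V'L g u V'g; rewrite mem_cat (L1cov _ Eu Su) => /(_ isT).
  by rewrite dotC ug eqxx.
have /nbhs_closedballP[r rV'] : nbhs g0 V' by exact: open_nbhs_nbhs.
set Q := closed_ball g0 r%:num in rV'.
have cQ : compact Q.
  apply: bounded_closed_compact; last exact: closed_ball_closed.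
  exists (`|g0| + r%:num); split; first exact: num_real.
  move=> M rM x; rewrite /Q closed_ballE// /closed_ball_ /= => xr.
  apply: le_trans (ltW rM); rewrite -[x](subKr g0).
  by apply: le_trans (ler_normB _ _) _; rewrite lerD2l.
(* Each piece [F l] collects the normals with an eigenvector near [l]; two such
   eigenvectors cannot be orthogonal. *)
have [|l Sl|L3 L3S L3cov] := @compact_finite_cover R _ S
    (fun l => [set x | dot (x - l) (x - l) < dot l l / 16]) cS.
- by move=> l _; apply: open_ltf; cont.
- by rewrite /= subrr dot0l divr_gt0// dot_gt0 unit0//; case: Sl.
pose T l := (S `*` Q) `&` ([set q | dot (q.1 - l) (q.1 - l) <= dot l l / 16] `&`
   [set q | compressed_eigen B q.2 q.1]).
pose F l := snd @` T l.
have cF l : closed (F l).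
  apply: compact_closed; first exact: norm_hausdorff.
  apply: continuous_compact; first by apply: continuous_subspaceT; exact: continuous_sndf.
  apply: compact_closedI; first exact: compact_setX.
  apply: closedI; first by apply: closed_lef; cont.
  by apply: closed_and; apply: closed_eqf; rewrite /bil; cont.
have [|||l lL3 [W [oW [g1 Wg1] WQ WF]]] :=
    @interior_finite_closed_cover _ _ L3 F (ball g0 r%:num) cF.
- exact: ball_open.
- by exists g0; exact: ballxx.
- move=> g gr; have Qg : Q g by exact: subset_closure.
  have [_ [u Su ug]] := VK _ (V'V _ (rV' _ Qg)).
  have [l lL3 ul] := L3cov _ Su; exists l => //.
  by exists (u, g) => //; split=> //; split => //=; exact: ltW.
have WV' g : W g -> V' g by move=> /WQ gr; apply: rV'; exact: subset_closure.
have l0 : l != 0 by apply: unit0; case: (L3S _ lL3).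
have ll : 0 < dot l l by rewrite dot_gt0.
have [[u1 g1'] [[/= Su1 _] [/= u1l ug1]] /= E1] := WF _ Wg1.
rewrite {g1'}E1 in ug1.
have u11 : bil B u1 u1 = 1 by case: Su1.
have g10 : g1 != 0 by have [] := VK _ (V'V _ (WV' _ Wg1)).
pose k := dot u1 u1 * bil B u1 g1 / dot g1 g1.
have gg1 : dot g1 g1 != 0 by rewrite dot_eq0.
have k0 : k != 0.
  rewrite /k !mulf_neq0 ?invr_eq0// ?dot_eq0 ?unit0//.
  exact: nondeg (WV' _ Wg1) Su1 ug1.
(* [G u] is the normal of the hyperplane for which [u] is an eigenvector of the
   compression of [B], scaled so that [G u1] is [g1]. *)
pose G u := k^-1 *: (dot u u *: (u *m B) - bil B u u *: u).
have cG : continuous G by rewrite /G /bil; cont.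
apply: (@all_mirrors_of_open K
    ([set u | dot (u - l) (u - l) < dot l l / 8] `&` [set u | W (G u)]) u1) => //.
- apply: openI; first by apply: open_ltf; cont.
  by apply: (@open_comp _ _ G W) => // x _; exact: cG.
- split => /=; first by apply: le_lt_trans u1l _; lra.
  suff -> : G u1 = g1 by [].
  have [_ uE] := ug1; apply: (scalerI k0); rewrite scalerA divff// scale1r.
  apply: (scalerI gg1); rewrite scalerBr !scalerA u11 mulr1 mulrC uE u11 mulr1.
  by rewrite addrAC subrr add0r; congr (_ *: _); rewrite /k [RHS]mulrC divfK.
move=> u [/= ul WGu] uu1.
set g := G u in WGu.
have ug : dot u g = 0.
  by rewrite /g /G !dot_linE -[dot u (u *m B)]dotC -[dot (u *m B) u]/(bil B u u) uu1; ring.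
have uE : dot u u *: (u *m B) = u + k *: g.
  by rewrite /g /G scalerA divff// scale1r uu1 scale1r addrC subrK.
have V'g := WV' _ WGu.
have [gn0 _] := VK _ (V'V _ V'g).
have gg : dot g g != 0 by rewrite dot_eq0.
have bug : dot u u * bil B u g = k * dot g g.
  by rewrite /bil -dotZl uE dotDl dotZl ug add0r.
have ceu : compressed_eigen B g u.
  split => //; rewrite uu1 mulr1 bug [dot u u * dot g g]mulrC -[LHS]scalerA uE scalerDr scalerA.
  by rewrite [dot g g * k]mulrC.
have [[u' g'] [[/= Su' _] [/= u'l ug']] /= E2] := WF _ WGu.
rewrite {g'}E2 in ug'.
have bug0 : bil B u g != 0.
  apply: contraNneq gg => b0; have /eqP := bug.
  by rewrite b0 mulr0 eq_sym mulf_eq0 (negbTE k0).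
have uu' : dot u u' != 0.
  rewrite gt_eqF//; apply: (dot_gt0_near l0 ul).
  by apply: le_lt_trans u'l _; lra.
have L2cov' x : E x -> exists2 l, l \in L2 & 0 < bil B l x by move=> /L2cov.
have V'L2 l' : l' \in L2 -> dot g l' != 0.
  by move=> l'L; apply: V'L => //; rewrite mem_cat l'L orbT.
have [u'E|u'E] := compressed_eigen_unique pB L2E L2cov' V'L2 gn0 uu1 Su'.1 ceu ug' bug0 uu'.
  by rewrite -u'E.
by rewrite -[u]opprK -u'E; exact: mirror_dirs_opp.
Qed.

End Dichotomy.

Theorem theorem1 (R : realType) (n : nat) (hn : (2 <= n)%N)
  (K : set 'rV[R]_n) (hK : convex_body K)
  (hU : exists U : set (grassmannian R n.-1 n),
     [/\ open U, U !=set0 & forall G, U G -> strong_bezdek K (val G)]) :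
  ellipsoid K \/ S1_rotational K.
Proof.
have n0 : (0 < n)%N by exact: ltnW.
have [U [oU U0 UK]] := hU.
have [V [oV V0 VU]] := open_normals n0 oU U0.
have [B [x0 [pB inv]]] := invariant_structure hK.
have [cK _ _] := hK.
have clK : closed [set x | K (x0 + x)].
  by apply: compact_closed; [exact: norm_hausdorff|exact: compact_translate].
have [|close|all] := @mirrors_everywhere_or_eigen_circle R n B pB
    [set x | K (x0 + x)] V clK oV V0.
- move=> g /VU[g0 [G UG GE]]; split => //.
  have [u u1 [ug Ku]] := strong_bezdek_direction pB inv (UK _ UG) g0 GE.
  by exists u.
- have [e1 [e2 [ortho E1 E2 circ]]] := eigen_circle pB clK close.
  by right; exact: rotational_of_circle circ.
- by left; exact: ellipsoid_of_mirrors all.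
Qed.
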